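(* Let $\mathbb K$ be a field, let $J\subseteq R=\mathbb K[x_0,\dots,x_n]$ be a quasi-stable ideal of codimension $c$, and let $\mathcal H=\{h_1,\dots,h_t\}$ be a $\mathcal P_J$-marked basis. There exist a non-empty subset $\mathcal K\subseteq\mathcal H$ and a partition $\mathcal K=\mathcal K_1\cup\dots\cup\mathcal K_c$ into non-empty subsets such that the polynomials $$f_1=\sum_{f\in\mathcal K_1}r_{1,f}f,\ \dots,\ f_c=\sum_{f\in\mathcal K_c}r_{c,f}f$$ generate an ideal of codimension $c$ in $R$ for values of $r_{i,f}$ varying in a suitable non-empty Zariski open subset.
   Context: $R=\mathbb K[x_0,\dots,x_n]$ has the standard grading and variables ordered $x_0<x_1<\dots<x_n$. A term is a monomial $x^\alpha=x_0^{\alpha_0}\cdots x_n^{\alpha_n}$; for $x^\alpha\neq 1$, $\min(x^\alpha)$ (resp. $\max(x^\alpha)$) is the smallest (resp. largest) variable dividing $x^\alpha$. A monomial ideal $J$ is quasi-stable if for every term $x^\tau\in J$ and every variable $x_k>\min(x^\tau)$ there is an exponent $s_k$ with $\frac{x^\tau}{\min(x^\tau)}x_k^{s_k}\in J$. This holds if and only if $J$ has a (unique) Pommaret basis $\mathcal P_J$: a finite set of terms generating $J$ such that for every term $x^\tau\in J\setminus\mathcal P_J$ there is a unique $x^\sigma\in\mathcal P_J$ with $x^\tau=x^\delta x^\sigma$ and $\max(x^\delta)\le\min(x^\sigma)$. $\mathcal N(J)$ is the set of terms not in $J$, and $\mathcal N(J)_s$ its subset of terms of degree $s$. A $\mathcal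 P_J$-marked set is a set $\mathcal H=\{h_\alpha\}_{x^\alpha\in\mathcal P_J}\subset R$ of homogeneous polynomials, one for each $x^\alpha\in\mathcal P_J$, such that $x^\alpha$ (the head term of $h_\alpha$) occurs in $h_\alpha$ with coefficient $1$ and all other terms occurring in $h_\alpha$ belong to $\mathcal N(J)$. It is a $\mathcal P_J$-marked basis if $R_s=(\mathcal H)_s\oplus\langle\mathcal N(J)_s\rangle_{\mathbb K}$ for every degree $s$. Codimension of an ideal means its height. The Zariski open subset is taken in the affine space over $\mathbb K$ with coordinates $r_{i,f}$, for $1\le i\le c$ and $f\in\mathcal K_i$. *)

(* Defs.v *)
From HB Require Import structures.
From mathcomp Require Import all_boot all_order all_algebra.
From mathcomp Require Import mpoly.

Set Implicit Arguments.
Unset Strict Implicit.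
Unset Printing Implicit Defensive.

Import GRing.Theory.

Local Open Scope ring_scope.

Section Ideals.

Variable A : comNzRingType.

Definition gen_ideal (G : A -> Prop) (p : A) : Prop :=
  exists (k : nat) (a g : 'I_k -> A),
    (forall i, G (g i)) /\ p = \sum_(i < k) a i * g i.

(* [idealr_closed] includes properness.  Subsets of the ring are boolean
   predicates here, as in [ring_quotient]; in the classical setting these are
   all the subsets. *)
Definition prime_ideal (P : {pred A}) : Prop :=
  idealr_closed P /\ prime_idealr_closed P.

(* Strict chain [C 0 < ... < C k = P] of prime ideals. *)
Definition prime_chain (k : nat) (P : {pred A}) : Prop :=
  exists C : nat -> {pred A},
    [/\ forall i, (i <= k)%N -> prime_ideal (C i),
        forall i, (i < k)%N ->
          {subset C i <= C i.+1} /\ exists2 x, x \in C i.+1 & x \notin C i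
      & C k =i P].

(* The codimension of [I] is its height: the minimum, over the primes [P]
   containing [I], of the supremum of the lengths of the chains ending at [P].
   The unit ideal has no codimension. *)
Definition codim (I : A -> Prop) (c : nat) : Prop :=
  (forall P : {pred A}, prime_ideal P -> (forall x, I x -> x \in P) ->
     prime_chain c P)
  /\ exists P : {pred A},
       [/\ prime_ideal P, forall x, I x -> x \in P
         & forall k, prime_chain k P -> (k <= c)%N].

End Ideals.

(* Variables are ordered by their index in ['I_n]. *)
Definition is_min_var (n : nat) (m : 'X_{1..n}) (i : 'I_n) : Prop :=
  (0 < m i)%N /\ forall j : 'I_n, (0 < m j)%N -> (i <= j)%N.

Definition is_max_var (n : nat) (m : 'X_{1..n}) (i : 'I_n) : Prop :=
  (0 < m i)%N /\ forall j : 'I_n, (0 < m j)%N -> (j <= i)%N.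

Section Marked.

Variables (K : fieldType) (n : nat).

Implicit Types (J : {mpoly K[n]} -> Prop) (p : {mpoly K[n]}).

Definition gen_terms (T : 'X_{1..n} -> Prop) : {mpoly K[n]} -> Prop :=
  gen_ideal (fun q => exists2 m, T m & q = 'X_[m]).

Definition monomial_ideal J : Prop :=
  exists T : 'X_{1..n} -> Prop, forall p, J p <-> gen_terms T p.

Definition quasi_stable J : Prop :=
  monomial_ideal J /\
  forall (m : 'X_{1..n}) (i k : 'I_n),
    J 'X_[m] -> is_min_var m i -> (i < k)%N ->
    exists s : nat, J 'X_[(m - U_(i) + U_(k) *+ s)%MM].

Definition pommaret_basis J (P : seq 'X_{1..n}) : Prop :=
  (forall p, J p <-> gen_terms (fun m => m \in P) p) /\
  forall m : 'X_{1..n}, J 'X_[m] -> m \notin P ->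
    exists! u : 'X_{1..n}, u \in P /\
      exists d : 'X_{1..n}, m = (d + u)%MM /\
        forall i j : 'I_n, is_max_var d i -> is_min_var u j -> (i <= j)%N.

Section MarkedSet.

Variables (t : nat) (J : {mpoly K[n]} -> Prop).
Variables (P : t.-tuple 'X_{1..n}) (h : 'I_t -> {mpoly K[n]}).

Definition marked_set : Prop :=
  forall i : 'I_t,
    [/\ exists d : nat, h i \is d.-homog,
        (h i)@_(tnth P i) = 1
      & forall m, m \in msupp (h i) -> m != tnth P i -> ~ J 'X_[m]].

Definition ideal_part (s : nat) p : Prop :=
  gen_ideal (fun q => exists i, q = h i) p /\ p \is s.-homog.

Definition span_nonterms (s : nat) p : Prop :=
  exists (k : nat) (a : 'I_k -> K) (m : 'I_k -> 'X_{1..n}),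
    (forall i, mdeg (m i) = s /\ ~ J 'X_[m i]) /\
    p = \sum_(i < k) a i *: 'X_[m i].

Definition marked_basis : Prop :=
  marked_set /\
  forall s : nat,
    (forall p, p \is s.-homog ->
       exists q r, [/\ ideal_part s q, span_nonterms s r & p = q + r])
    /\ (forall p, ideal_part s p -> span_nonterms s p -> p = 0).

End MarkedSet.

End Marked.

Section AffineSpace.

(* The affine space over [K] with coordinates indexed by [I].  An open subset
   is the complement of the common zeros of a finite family of polynomials over
   [K].  Since [K] may be finite, points are taken with values in arbitrary
   field extensions of [K], so that "non-empty open" is not read off the
   [K]-rational points alone. *)
Variables (K : fieldType) (I : finType).

Definition zariski_open : Type := seq {mpoly K[#|I|]}.

Definition in_open (U : zariski_open) (L : fieldType)
    (iota : {rmorphism K -> L}) (r : I -> L) : Prop :=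
  exists2 g, g \in U & mmap iota (fun k => r (enum_val k)) g != 0.

Definition nonempty_open (U : zariski_open) : Prop :=
  exists (L : fieldType) (iota : {rmorphism K -> L}) (r : I -> L),
    in_open U iota r.

End AffineSpace.

Section Combinations.

Variables (c t : nat) (B : 'I_c -> {set 'I_t}).

(* Index pairs [(i, j)] with [j \in B i]. *)
Definition coords : finType := {u : 'I_c * 'I_t | u.2 \in B u.1}.

Definition combination (n : nat) (K L : fieldType) (iota : {rmorphism K -> L})
    (h : 'I_t -> {mpoly K[n]}) (r : coords -> L) (i : 'I_c) : {mpoly L[n]} :=
  \sum_(u : coords | (val u).1 == i) r u *: map_mpoly iota (h (val u).2).

End Combinations.

(* Main.v *)
Require Import Defs.
From HB Require Import structures.
From mathcomp Require classical_sets.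
From mathcomp Require Import boolp.
From mathcomp Require Import all_boot all_order all_algebra ring.
From mathcomp Require Import mpoly.

(* Let x_k range over the variables a power of which lies in J; by
   quasi-stability J lies in the prime they generate, so there are at least c of
   them, and kappa picks c distinct ones.  The class K_i consists of the h_j
   whose head term has minimal variable kappa i.

   For a set A of these variables, the head terms supported in A form the
   Pommaret basis of an Artinian ideal of K[x_A]; Pommaret reduction, which does
   not need a term order, shows that modulo the h_j with minimal variable in A
   the exponents of the variables in A can be bounded.  Hence these h_j generate
   an ideal of codimension at least |A|.

   Consider the generic combinations F_i over K[r, x], r being the
   coefficients, and a prime containing all of them.  For each i, either the
   prime contains the whole class K_i, or F_i = 0 expresses one of the
   coefficients as a rational function of the other variables.  Counting
   dimensions, at most #r + (n - c) variables (n the number of the x_k) are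
   independent modulo the prime.  So for each set Y of n - c + 1 of the x_k
   there is a nonzero polynomial in r and Y lying in the ideal of the F_i; the
   open set is given by the non-vanishing of one of its coefficients, for every
   Y.  Over it no n - c + 1 variables are independent modulo the ideal of the
   specialized combinations, which bounds heights from below.

   The combinations vanish at the origin, so that n - c variables are
   independent modulo their ideal; a prime over it keeping them independent has
   height at most c.

   All dimensions are measured by the growth of families of polynomials that
   are linearly independent modulo an ideal. *)

Set Implicit Arguments.
Unset Strict Implicit.
Unset Printing Implicit Defensive.

Import GRing.Theory.

Local Open Scope ring_scope.

(** * Ideals and quotients by primes *)

Definition is_ideal (A : comNzRingType) (I : A -> Prop) : Prop :=
  [/\ I 0, forall x y, I x -> I y -> I (x + y)
    & forall a x, I x -> I (a * x)].

Section Ideal.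

Variables (A : comNzRingType) (I : A -> Prop).
Hypothesis idI : is_ideal I.

Lemma ideal0 : I 0. Proof. by case: idI. Qed.

Lemma idealD x y : I x -> I y -> I (x + y).
Proof. by case: idI => _ + _; exact. Qed.

Lemma idealM a x : I x -> I (a * x).
Proof. by case: idI => _ _; exact. Qed.

Lemma idealN x : I x -> I (- x).
Proof. by rewrite -mulN1r; exact: idealM. Qed.

Lemma idealB x y : I x -> I y -> I (x - y).
Proof. by move=> Ix /idealN; exact: idealD. Qed.

Lemma ideal_sum (T : Type) (s : seq T) (P : pred T) (F : T -> A) :
  (forall i, P i -> I (F i)) -> I (\sum_(i <- s | P i) F i).
Proof.
by move=> IF; elim/big_ind: _ => //; [exact: ideal0 | exact: idealD].
Qed.

End Ideal.

Lemma gen_ideal_is_ideal (A : comNzRingType) (G : A -> Prop) :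
  is_ideal (gen_ideal G).
Proof.
split.
- by exists 0%N, (fun=> 0), (fun=> 0); split=> [[]|] //; rewrite big_ord0.
- move=> x y [k [a [g [Gg ->]]]] [l [b [g' [Gg' ->]]]].
  exists (k + l)%N,
    (fun i => match split i with inl j => a j | inr j => b j end),
    (fun i => match split i with inl j => g j | inr j => g' j end).
  split=> [i|]; first by case: split.
  rewrite big_split_ord /=; congr (_ + _); apply: eq_bigr => i _.
    by rewrite -[lshift _ _]/(unsplit (inl i)) unsplitK.
  by rewrite -[rshift _ _]/(unsplit (inr i)) unsplitK.
- move=> c x [k [a [g [Gg ->]]]]; exists k, (fun i => c * a i), g; split=> //.
  by rewrite mulr_sumr; apply: eq_bigr => i _; rewrite mulrA.
Qed.

Lemma mem_gen_ideal (A : comNzRingType) (G : A -> Prop) x :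
  G x -> gen_ideal G x.
Proof.
move=> Gx; exists 1%N, (fun=> 1), (fun=> x).
by split=> //; rewrite big_ord1 mul1r.
Qed.

Lemma gen_ideal_sub (A : comNzRingType) (G I : A -> Prop) :
  is_ideal I -> (forall x, G x -> I x) -> forall x, gen_ideal G x -> I x.
Proof.
move=> idI GI _ [k [a [g [Gg ->]]]].
by apply: ideal_sum => // i _; apply: idealM => //; apply: GI.
Qed.

Lemma prime_ideal_is_ideal (A : comNzRingType) (P : {pred A}) :
  prime_ideal P -> is_ideal (fun x => x \in P).
Proof.
case=> [[P0 _ Pl] _]; split=> // [x y Px Py|a x Px].
  by rewrite -[x]mul1r; apply: Pl.
by rewrite -[_ * _]addr0; apply: Pl.
Qed.

Lemma prime_ideal1 (A : comNzRingType) (P : {pred A}) :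
  prime_ideal P -> 1 \notin P.
Proof. by case=> [[]]. Qed.

Section Domain.

Variable D : comNzRingType.
Hypothesis domD : forall x y : D, x * y = 0 -> (x == 0) || (y == 0).

(** An [idomainType] carries an inverse operation, so one is chosen classically: an actual inverse
    for each unit, the identity elsewhere. *)
Let inv_spec (x : D) : exists y : D,
  if `[< exists y, y * x = 1 >] then y * x = 1 else y = x.
Proof.
by case: asboolP => // _; exists x.
Qed.

Let unitD : pred D := fun x => `[< exists y, y * x = 1 >].
Let invD x := sval (cid (inv_spec x)).

Let mulVD : {in unitD, left_inverse 1 invD *%R}.
Proof.
move=> x ux; rewrite /invD; case: cid => y /=.
by rewrite (ux : `[< _ >] = true).
Qed.

Let unitDP (x y : D) : y * x = 1 -> unitD x.
Proof. by move=> yx; apply/asboolP; exists y. Qed.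

Let invD_out : {in [predC unitD], invD =1 id}.
Proof.
move=> x /negbTE ux; rewrite /invD; case: cid => y /=.
by rewrite (ux : `[< _ >] = false).
Qed.

Definition domain_copy : Type := D.

HB.instance Definition _ := GRing.ComNzRing.on domain_copy.
HB.instance Definition _ :=
  GRing.ComNzRing_hasMulInverse.Build domain_copy mulVD unitDP invD_out.
HB.instance Definition _ := GRing.ComUnitRing_isIntegral.Build domain_copy domD.

Lemma domain_structure : exists (E : idomainType) (f : {rmorphism D -> E}),
  injective f.
Proof.
by exists domain_copy, (@idfun domain_copy : {rmorphism D -> domain_copy}).
Qed.

End Domain.

(** [D] is the quotient by [P]; presenting [P] as a kernel turns membership into equations in a
    domain. *)
Lemma prime_ideal_ker (A : comNzRingType) (P : {pred A}) : prime_ideal P ->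
  exists (D : idomainType) (f : {rmorphism A -> D}),
    forall x, (x \in P) = (f x == 0).
Proof.
move=> [idP prP].
pose I : prime_idealr A := HB.pack (P : A -> bool)
  (isIdealr.Build A P idP) (isPrimeIdealrClosed.Build A P prP).
have [D [f injf]] := domain_structure (@Quotient.rquot_IdomainAxiom A I).
exists D, (f \o (\pi_{ideal_quot I})%qT : {rmorphism A -> D}) => x.
have fE y : (f y == 0) = (y == 0) by rewrite -(rmorph0 f) (inj_eq injf).
rewrite /= fE; have := @Quotient.idealrBE A I x 0; rewrite subr0 => ->.
by rewrite /= rmorph0.
Qed.

Section PrimeAvoiding.

Variables (A : comNzRingType) (I S : A -> Prop).
Hypotheses (idI : is_ideal I) (S1 : S 1).
Hypothesis SM : forall x y, S x -> S y -> S (x * y).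
Hypothesis IS : forall x, I x -> ~ S x.

Let avoiding (J : A -> Prop) : Prop :=
  [/\ is_ideal J, forall x, I x -> J x & forall x, J x -> ~ S x].

Let le (J J' : {J | avoiding J}) : bool :=
  `[< forall x, sval J x -> sval J' x >].

Let exists_maximal : exists2 J, avoiding J &
  forall J', avoiding J' -> (forall x, J x -> J' x) -> forall x, J' x -> J x.
Proof.
have avI : avoiding I by [].
have [||C totC|[J avJ] maxJ] :=
  @classical_sets.ZL_preorder _ (exist _ _ avI) le.
- by move=> J; apply/asboolP.
- by move=> J1 J2 J3 /asboolP h1 /asboolP h2; apply/asboolP => x /h1 /h2.
(* The union of the chain, with [I] added so that the empty chain is bounded too. *)
- pose U x := I x \/ exists2 J, C J & sval J x.
  have idJ (J : {J | avoiding J}) : is_ideal (sval J) by have [] := svalP J.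
  have IJ (J : {J | avoiding J}) x : I x -> sval J x.
    by have [_ + _] := svalP J; exact.
  have JS (J : {J | avoiding J}) x : sval J x -> ~ S x.
    by have [_ _] := svalP J; exact.
  have Uin (J : {J | avoiding J}) x y : C J -> sval J x -> U y ->
      exists J', [/\ C J', sval J' x & sval J' y].
    move=> CJ Jx [Iy|[J' CJ' J'y]].
      by exists J; split=> //; exact: IJ.
    case: (totC J J' CJ CJ') => /asboolP h.
      by exists J'; split=> //; exact: h.
    by exists J; split=> //; exact: h.
  have avU : avoiding U.
    split; first split.
    + by left; exact: ideal0.
    + move=> x y [Ix|[J CJ Jx]] Uy.
        case: Uy => [Iy|[J CJ Jy]]; first by left; exact: idealD.
        by right; exists J => //; apply: idealD => //; exact: IJ.
      have [J' [CJ' J'x J'y]] := Uin _ _ _ CJ Jx Uy.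
      by right; exists J' => //; apply: idealD.
    + move=> a x [Ix|[J CJ Jx]]; first by left; exact: idealM.
      by right; exists J => //; apply: idealM.
    + by move=> x; left.
    + by move=> x [/IS //|[J _ /JS]].
  exists (exist _ U avU) => J CJ; apply/asboolP => x Jx; right.
  by exists J.
exists J => // J' avJ' JJ' x J'x.
have /asboolP := maxJ (exist _ _ avJ') (introT (asboolP _) JJ').
by apply.
Qed.

(** Krull's argument: an ideal maximal among those that contain [I] and miss the multiplicative set
    [S] is prime. *)
Lemma exists_prime_avoiding : exists P : {pred A},
  [/\ prime_ideal P, forall x, I x -> x \in P & forall x, x \in P -> ~ S x].
Proof.
have [J [idJ IJ JS] maxJ] := exists_maximal.
(* By maximality, adjoining an element outside [J] yields an ideal that meets [S]. *)
have extJ x : ~ J x -> exists j a, J j /\ S (j + a * x).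
  move=> nJx; apply: contrapT => nS.
  pose J' y := exists j a, J j /\ y = j + a * x.
  apply: nJx; apply: (maxJ J'); last first.
  - by exists 0, 1; rewrite add0r mul1r; split=> //; exact: ideal0.
  - by move=> y Jy; exists y, 0; rewrite mul0r addr0.
  split; first split.
  - by exists 0, 0; rewrite mul0r addr0; split=> //; exact: ideal0.
  - move=> _ _ [j [a [Jj ->]]] [k [b [Jk ->]]]; exists (j + k), (a + b).
    by rewrite mulrDl addrACA; split=> //; exact: idealD.
  - move=> c _ [j [a [Jj ->]]]; exists (c * j), (c * a).
    by rewrite mulrDr mulrA; split=> //; exact: idealM.
  - by move=> y Iy; exists y, 0; rewrite mul0r addr0; split=> //; exact: IJ.
  - by move=> _ [j [a [Jj ->]]] Sy; apply: nS; exists j, a.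
exists (fun x => `[< J x >]); split.
- split; first split.
  + by apply/asboolP; exact: ideal0.
  + by apply/asboolP => /JS.
  + move=> a x y /asboolP Jx /asboolP Jy; apply/asboolP.
    by apply: idealD => //; exact: idealM.
  + move=> x y /asboolP Jxy; apply/orP; apply: contrapT => nJ.
    have nJx : ~ J x by move=> Jx; apply: nJ; left; apply/asboolP.
    have nJy : ~ J y by move=> Jy; apply: nJ; right; apply/asboolP.
    have [j [a [Jj Sa]]] := extJ _ nJx; have [k [b [Jk Sb]]] := extJ _ nJy.
    apply: (JS _ _ (SM Sa Sb)).
    have -> : (j + a * x) * (k + b * y) =
        (k + b * y) * j + a * x * k + a * b * (x * y).
      by rewrite mulrDl [X in _ + X]mulrDr mulrACA addrA [j * _]mulrC.
    by apply: idealD; [done|apply: idealD|]; rewrite //; apply: idealM.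
- by move=> x Ix; apply/asboolP; exact: IJ.
- by move=> x /asboolP /JS.
Qed.

End PrimeAvoiding.

(** Expressed through the [M s], the [v t] give a matrix with more rows than columns; a nonzero row
    of its left kernel is the relation. *)
Lemma dependent_mod (K : fieldType) (E : lmodType K) (I : E -> Prop)
    (S T : finType) (M : S -> E) (v : T -> E) :
  I 0 -> (forall x y, I x -> I y -> I (x + y)) ->
  (forall a x, I x -> I (a *: x)) ->
  (forall t, exists a : S -> K, I (v t - \sum_s a s *: M s)) ->
  (#|S| < #|T|)%N ->
  exists c : T -> K, (exists t, c t != 0) /\ I (\sum_t c t *: v t).
Proof.
move=> I0 ID IZ /choice[a aP] ltST.
pose B : 'M[K]_(#|T|, #|S|) := \matrix_(i, j) a (enum_val i) (enum_val j).
have kerB : kermx B != 0.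
  by rewrite kermx_eq0 -row_leq_rank -ltnNge (leq_ltn_trans (rank_leq_col _)).
have /existsP[i /existsP[j nzij]] : [exists i, exists j, kermx B i j != 0].
  apply: contraNT kerB => /existsPn h; apply/eqP/matrixP => i j.
  by rewrite [RHS]mxE; have /existsPn/(_ j) := h i; rewrite negbK => /eqP.
exists (fun t => kermx B i (enum_rank t)); split.
  by exists (enum_val j); rewrite enum_valK.
have sumB s : \sum_t kermx B i (enum_rank t) * a t s = 0.
  have /matrixP/(_ i (enum_rank s)) := mulmx_ker B.
  rewrite !mxE (reindex _ (onW_bij _ (enum_rank_bij T))) /= => {2}<-.
  by apply: eq_bigr => t _; rewrite !mxE !enum_rankK.
suff -> : \sum_t kermx B i (enum_rank t) *: v t =
    \sum_t kermx B i (enum_rank t) *: (v t - \sum_s a t s *: M s).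
  by elim/big_ind: _ => // t _; apply: IZ.
under [RHS]eq_bigr do rewrite scalerBr scaler_sumr.
rewrite sumrB exchange_big /= [X in _ = _ - X]big1 ?subr0 // => s _.
by under eq_bigr do rewrite scalerA; rewrite -scaler_suml sumB scale0r.
Qed.

(** * Supports and exponent boxes *)

Lemma leq_expn (m n e : nat) : (m <= n -> m ^ e <= n ^ e)%N.
Proof. by case: e => // e lemn; rewrite leq_exp2r. Qed.

Lemma growth_le (C k a b : nat) :
  (forall s, s.+1 ^ a <= C * (k * s).+1 ^ b)%N -> (a <= b)%N.
Proof.
move=> le_s; rewrite leqNgt; apply/negP => ltba.
(* At [s = C'] the right-hand side is at most [s * s.+1 ^ b], which is below [s.+1 ^ b.+1]. *)
pose C' := (C * k.+1 ^ b)%N.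
have := le_s C'; rewrite leqNgt => /negP; apply.
apply: (@leq_trans (C'.+1 ^ b.+1)); last by rewrite leq_pexp2l.
rewrite expnSr mulnC.
have leb : ((k * C').+1 ^ b <= k.+1 ^ b * C'.+1 ^ b)%N.
  by rewrite -expnMn leq_expn // mulSn mulnS addSn ltnS addnA leq_addl.
apply: leq_ltn_trans (_ : C'.+1 ^ b * C' < _)%N; last first.
  by rewrite ltn_pmul2l // expn_gt0.
apply: leq_trans (leq_mul leb (leqnn C)) _.
by rewrite mulnAC [(_ * C)%N]mulnC -/C' mulnC.
Qed.

Section Support.

Variables (R : nzRingType) (n : nat).
Implicit Types (S : 'X_{1..n} -> Prop) (p q : {mpoly R[n]}).

Definition supp_in S p : Prop := forall m, m \in msupp p -> S m.

Lemma supp_inW S S' p : (forall m, S m -> S' m) -> supp_in S p -> supp_in S' p.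
Proof. by move=> SS' Sp m /Sp /SS'. Qed.

Lemma supp_in0 S : supp_in S 0.
Proof. by move=> m; rewrite msupp0. Qed.

Lemma supp_inX S m : S m -> supp_in S 'X_[m].
Proof. by move=> Sm m'; rewrite msuppX inE => /eqP ->. Qed.

Lemma supp_inD S p q : supp_in S p -> supp_in S q -> supp_in S (p + q).
Proof.
by move=> Sp Sq m /msuppD_le; rewrite mem_cat => /orP[/Sp|/Sq].
Qed.

Lemma supp_inN S p : supp_in S p -> supp_in S (- p).
Proof. by move=> Sp m; rewrite (perm_mem (msuppN p)) => /Sp. Qed.

Lemma supp_inZ S c p : supp_in S p -> supp_in S (c *: p).
Proof. by move=> Sp m /msuppZ_le /Sp. Qed.

Lemma supp_in_sum S (T : Type) (s : seq T) (P : pred T) F :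
  (forall i, P i -> supp_in S (F i)) -> supp_in S (\sum_(i <- s | P i) F i).
Proof.
by move=> SF; elim/big_ind: _ => //; [exact: supp_in0|exact: supp_inD].
Qed.

Lemma supp_inM S1 S2 S p q :
  (forall m1 m2, S1 m1 -> S2 m2 -> S (m1 + m2)%MM) ->
  supp_in S1 p -> supp_in S2 q -> supp_in S (p * q).
Proof.
move=> SS S1p S2q m /msuppM_le /allpairsP[[m1 m2] /= [/S1p h1 /S2q h2 ->]].
exact: SS.
Qed.

Lemma supp_in_coef0 S p m : supp_in S p -> ~ S m -> p@_m = 0.
Proof. by move=> Sp nS; apply: memN_msupp_eq0; apply/negP => /Sp. Qed.

End Support.

Lemma supp_in_span (R : nzRingType) (n : nat) (S : finType)
    (g : S -> 'X_{1..n}) (p : {mpoly R[n]}) :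
  supp_in (fun m => exists x, g x = m) p ->
  exists a : S -> R, p = \sum_x a x *: 'X_[g x].
Proof.
move=> supp_p.
(* [g] need not be injective, so each monomial is charged to one chosen preimage. *)
pose sec m := [pick x | g x == m].
exists (fun x => \sum_(m <- msupp p | sec m == Some x) p@_m).
under eq_bigr do rewrite scaler_suml.
rewrite (exchange_big_dep predT) //=.
apply: (etrans (mpolyE p)); apply: eq_big_seq => m.
move=> /supp_p[x gx]; have [y secm gy] : exists2 y, sec m = Some y & g y = m.
  rewrite /sec; case: pickP => [y /eqP gy|/(_ x)]; first by exists y.
  by rewrite gx eqxx.
by rewrite (big_pred1 y) ?gy // => z; rewrite secm (inj_eq Some_inj) eq_sym.
Qed.

Section Box.

Variables (R : nzRingType) (n : nat).

Definition box (b : 'I_n -> nat) : finType := {dffun forall i, 'I_(b i)}.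

Definition box_mnm b (f : box b) : 'X_{1..n} := [multinom (f i : nat) | i < n].

Lemma card_box b : #|box b| = (\prod_i b i)%N.
Proof.
rewrite card_dep_ffun foldrE big_map big_enum; apply: eq_bigr => i _.
by rewrite card_ord.
Qed.

Lemma box_mnm_inj b : injective (@box_mnm b).
Proof.
move=> f g /mnmP eqfg; apply/ffunP => i; apply: val_inj.
by have := eqfg i; rewrite !mnmE.
Qed.

Lemma box_mnm_surj b (m : 'X_{1..n}) :
  (forall i, (m i < b i)%N) -> exists f : box b, box_mnm f = m.
Proof.
move=> ltm; exists [ffun i => Ordinal (ltm i)].
by apply/mnmP => i; rewrite mnmE ffunE.
Qed.

Lemma box_coef b (c : box b -> R) f :
  (\sum_g c g *: 'X_[R, box_mnm g])@_(box_mnm f) = c f.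
Proof.
rewrite raddf_sum /= (bigD1 f) //= mcoeffZ mcoeffX eqxx mulr1 big1 ?addr0 //.
move=> g ngf.
by rewrite mcoeffZ mcoeffX (inj_eq (@box_mnm_inj _)) (negbTE ngf) mulr0.
Qed.

Lemma card_box_if (W : {set 'I_n}) (x y : nat) :
  #|box (fun i => if i \in W then x else y)| = (x ^ #|W| * y ^ (n - #|W|))%N.
Proof.
rewrite card_box (bigID (fun i => i \in W)) /=.
rewrite (eq_bigr (fun=> x)) ?prod_nat_const; last by move=> i ->.
rewrite [X in (_ * X)%N](eq_bigr (fun=> y)); last by move=> i /negbTE ->.
congr (_ * _)%N.
rewrite (eq_bigl (fun i => i \in ~: W)) => [|i]; last by rewrite !inE.
by rewrite prod_nat_const cardsCs setCK card_ord.
Qed.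

End Box.

Lemma box_dependent (K : fieldType) (n : nat) (I : {mpoly K[n]} -> Prop)
    (b : 'I_n -> nat) (T : finType) (v : T -> {mpoly K[n]}) :
  is_ideal I ->
  (forall t, exists q,
     supp_in (fun m => forall i, (m i < b i)%N) q /\ I (v t - q)) ->
  (#|box b| < #|T|)%N ->
  exists c : T -> K, (exists t, c t != 0) /\ I (\sum_t c t *: v t).
Proof.
move=> idI spanI ltbT.
apply: (dependent_mod (S := box b) (M := fun f => 'X_[box_mnm f])) => //.
- exact: ideal0.
- by move=> x y; exact: idealD.
- by move=> a x Ix; rewrite -mul_mpolyC; exact: idealM.
- move=> t; have [q [qb Iq]] := spanI t.
  have [|a aE] := @supp_in_span _ _ _ (@box_mnm n b) q.
    by move=> m /qb; exact: box_mnm_surj.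
  by exists a; rewrite -aE.
Qed.

Section Independent.

Variables (K : fieldType) (n : nat).
Implicit Types (I : {mpoly K[n]} -> Prop) (Z : {set 'I_n}).

Definition poly_in Z (p : {mpoly K[n]}) : Prop :=
  supp_in (fun m => forall i, i \notin Z -> m i = 0%N) p.

(** For a prime [I], algebraic independence over [K] of the classes of the variables in [Z]. *)
Definition indep_vars I Z : Prop := forall p, poly_in Z p -> I p -> p = 0.

Lemma poly_in1 Z : poly_in Z 1.
Proof. by rewrite -mpolyX0; apply: supp_inX => i; rewrite mnm0E. Qed.

Lemma poly_inM Z p q : poly_in Z p -> poly_in Z q -> poly_in Z (p * q).
Proof.
by apply: supp_inM => m1 m2 h1 h2 i iZ; rewrite mnmDE h1 ?h2.
Qed.

Lemma not_indep_vars I Z : ~ indep_vars I Z ->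
  exists p, [/\ poly_in Z p, I p & p != 0].
Proof.
move=> nI; apply: contrapT => nex; apply: nI => p pZ Ip.
by apply: contrapT => /eqP p0; apply: nex; exists p.
Qed.

Lemma box_poly_in Z s (c : box (fun i => if i \in Z then s.+1 else 1%N) -> K) :
  poly_in Z (\sum_f c f *: 'X_[box_mnm f]).
Proof.
apply: supp_in_sum => f _; apply: supp_inZ; apply: supp_inX => i iZ.
rewrite mnmE; case: (f i); rewrite (negbTE iZ) => k /=.
by case: k.
Qed.

(** The nonzero polynomials in [Z] form a multiplicative set that misses [I]; a prime avoiding it
    keeps [Z] independent. *)
Lemma exists_prime_indep I Z : is_ideal I -> indep_vars I Z ->
  exists P : {pred {mpoly K[n]}}, [/\ prime_ideal P,
    forall x, I x -> x \in P & indep_vars (fun x => x \in P) Z].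
Proof.
move=> idI indI.
have [||x Ix [xZ]|P [prP IP PS]] := @exists_prime_avoiding _ I
  (fun x => poly_in Z x /\ x != 0) idI.
- by split; [exact: poly_in1|exact: oner_neq0].
- by move=> x y [? ?] [? ?]; rewrite mulf_neq0 //; split=> //; exact: poly_inM.
- by rewrite (indI _ xZ Ix) eqxx.
- exists P; split=> // p pZ Pp; apply: contrapT => /eqP p0.
  by apply: (PS p).
Qed.

End Independent.

Lemma mpoly_rmorph_eq (R : nzRingType) (n : nat) (A : nzRingType)
    (f g : {rmorphism {mpoly R[n]} -> A}) :
  (forall c, f c%:MP = g c%:MP) -> (forall i, f 'X_i = g 'X_i) -> f =1 g.
Proof.
move=> eqC eqX p; rewrite (mpolyE p) !rmorph_sum; apply: eq_bigr => m _.
rewrite -mul_mpolyC !rmorphM eqC; congr (_ * _).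
rewrite mpolyXE_id !rmorph_prod; apply: eq_bigr => i _.
by rewrite !rmorphXn eqX.
Qed.

(** * Growth modulo an ideal and heights of primes *)

Section ChainBound.

Variables (K : fieldType) (n : nat).
Implicit Types (Q : {mpoly K[n]} -> Prop) (P : {pred {mpoly K[n]}}).

(** A lower bound of order [e] on the growth of the affine Hilbert function of the quotient by [Q],
    witnessed by explicit families. *)
Definition indep_growth Q (e : nat) : Prop := exists k, forall s,
  exists (T : finType) (v : T -> {mpoly K[n]}),
    [/\ #|T| = (s.+1 ^ e)%N,
        forall t, supp_in (fun m => mdeg m <= k * s)%N (v t)
      & forall c, Q (\sum_t c t *: v t) -> forall t, c t = 0].

Lemma indep_vars_growth Q Z : indep_vars Q Z -> indep_growth Q #|Z|.
Proof.
move=> indQ; exists n => s.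
exists (box (fun i => if i \in Z then s.+1 else 1%N)), (fun f => 'X_[box_mnm f]).
split=> [|f|c Qc f].
- by rewrite card_box_if exp1n muln1.
- apply: supp_inX; rewrite mdegE -[X in (_ <= X * _)%N]card_ord -sum_nat_const.
  by apply: leq_sum => i _; rewrite mnmE; case: (f i) => j /=; case: ifP; case: j.
- by rewrite -(box_coef c) (indQ _ (@box_poly_in _ _ _ _ c) Qc) mcoeff0.
Qed.

(** A strict inclusion gains one order of growth: the products of a family independent modulo [Q]
    with the powers [g ^+ j], [j <= s], are independent modulo [P]. *)
Lemma indep_growth_prime P Q e g : prime_ideal P -> is_ideal Q ->
  (forall x, x \in P -> Q x) -> Q g -> g \notin P ->
  indep_growth Q e -> indep_growth (fun x => x \in P) e.+1.
Proof.
move=> prP idQ PQ Qg Pg [k grQ]; exists (k + msize g)%N => s.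
have [T [v [cardT degv indv]]] := grQ s.
have degX j : supp_in (fun m => mdeg m <= msize g * j)%N (g ^+ j).
  elim: j => [|j IHj].
    by rewrite expr0 -mpolyX0; apply: supp_inX; rewrite mdeg0.
  rewrite exprS;
    apply: supp_inM (fun m h => ltnW (msize_mdeg_lt h)) IHj => m1 m2 h1 h2.
  by rewrite mdegD mulnS leq_add.
exists (T * 'I_s.+1)%type,
  (fun u : T * 'I_s.+1 => v u.1 * g ^+ (u.2 : nat)).
split=> [|[t j]|c Pc].
- by rewrite card_prod cardT card_ord expnSr.
- apply: supp_inM (degv t) (degX j) => m1 m2 h1 h2 /=.
  rewrite mdegD mulnDl leq_add // (leq_trans h2) // leq_mul2l -ltnS ltn_ord.
  by rewrite orbT.
- pose w j := \sum_t c (t, inord j) *: v t.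
  have wQ j : Q (w j) -> w j = 0.
    by move=> /indv c0; apply: big1 => t _; rewrite c0 scale0r.
  (* The constant coefficient of a relation in powers of [g] lies in [Q], so it is zero; the rest is
     a multiple of [g], which cancels modulo the prime [P]. *)
  have wP N (u : nat -> {mpoly K[n]}) : (forall j, Q (u j) -> u j = 0) ->
      \sum_(j < N) u j * g ^+ j \in P -> forall j, (j < N)%N -> u j = 0.
    elim: N u => // N IHN u uQ; rewrite big_ord_recl expr0 mulr1 => Pu.
    have idP := prime_ideal_is_ideal prP.
    have split_sum : \sum_(i < N) u (lift ord0 i) * g ^+ lift ord0 i =
        g * \sum_(i < N) u i.+1 * g ^+ i.
      rewrite mulr_sumr; apply: eq_bigr => i _.
      by rewrite lift0 exprS mulrCA.
    have u0 : u 0%N = 0.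
      apply: uQ; rewrite -[u 0%N](addrK
        (\sum_(i < N) u (lift ord0 i) * g ^+ lift ord0 i)).
      apply: idealB => //; first exact: PQ.
      by rewrite split_sum mulrC; apply: idealM.
    case=> [//|j] ltj; apply: (IHN (fun j => u j.+1)) => // [i|].
      exact: uQ.
    move: Pu; rewrite u0 add0r split_sum.
    by case: prP => _ prP /prP; rewrite (negbTE Pg).
  have sumE : \sum_u c u *: (v u.1 * g ^+ (u.2 : nat)) =
      \sum_(j < s.+1) w j * g ^+ j.
    rewrite (eq_bigr (fun u : T * 'I_s.+1 =>
      c (u.1, u.2) *: (v u.1 * g ^+ (u.2 : nat)))) => [|[]//].
    rewrite -(pair_bigA _ (fun (t : T) (j : 'I_s.+1) =>
      c (t, j) *: (v t * g ^+ (j : nat)))) exchange_big /=.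
    apply: eq_bigr => j _; rewrite /w mulr_suml; apply: eq_bigr => t _.
    by rewrite inord_val scalerAl.
  move=> [t j]; rewrite sumE in Pc.
  have := wP _ w wQ Pc j (ltn_ord j).
  move=> w0; have := indv (fun t => c (t, inord j)); rewrite -/(w j) w0.
  by move=> /(_ (ideal0 idQ) t); rewrite inord_val.
Qed.

(** Polynomials of degree at most [k * s] are spanned by [(k * s).+1 ^ n] monomials, which caps the
    order of growth. *)
Lemma indep_growth_le Q e : is_ideal Q -> indep_growth Q e -> (e <= n)%N.
Proof.
move=> idQ [k grQ]; apply: (@growth_le 1 k e n) => s.
have [T [v [cardT degv indv]]] := grQ s.
rewrite mul1n leqNgt -cardT; apply/negP => ltT.
have [||c [[t ct] Qc]] := @box_dependent K n Q (fun=> (k * s).+1) T v idQ.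
- move=> t; exists (v t); rewrite subrr; split; last exact: ideal0.
  apply: supp_inW (degv t) => m lem i; rewrite ltnS; apply: leq_trans lem.
  by rewrite mdegE (bigD1 i) //= leq_addr.
- by rewrite card_box prod_nat_const card_ord.
- by rewrite (indv _ Qc) eqxx in ct.
Qed.

(** Going down the chain from [P], the growth starts with order [#|Z|] and gains one at each of the
    [k] steps, yet never exceeds [n]. *)
Lemma prime_chain_le P Z k : indep_vars (fun x => x \in P) Z ->
  prime_chain k P -> (k + #|Z| <= n)%N.
Proof.
move=> indP [C [prC ltC eqC]].
have grC i : (i <= k)%N -> indep_growth (fun x => x \in C (k - i)%N) (i + #|Z|).
  elim: i => [_|i IHi lti].
    rewrite subn0 add0n; apply: indep_vars_growth => p pZ.
    by rewrite eqC; exact: indP.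
  have ltk : (k - i.+1 < k)%N by rewrite ltn_subrL (leq_trans _ lti).
  have [subC [x x1 x0]] := ltC _ ltk.
  have ES : (k - i.+1).+1 = (k - i)%N by rewrite subnSK.
  rewrite ES in subC x1.
  apply: indep_growth_prime x1 x0 (IHi (ltnW lti)) => //.
    by apply: prC; exact: leq_subr.
  by apply: prime_ideal_is_ideal; apply: prC; exact: leq_subr.
have := grC k (leqnn k); rewrite subnn; apply: indep_growth_le.
by apply: prime_ideal_is_ideal; apply: prC.
Qed.

End ChainBound.

Lemma rmorph_ker_prime (A : comNzRingType) (D : idomainType)
    (f : {rmorphism A -> D}) : prime_ideal (fun x => f x == 0).
Proof.
split; first split.
- by rewrite unfold_in rmorph0.
- by rewrite unfold_in rmorph1 oner_eq0.
- move=> a x y; rewrite !unfold_in rmorphD rmorphM => /eqP -> /eqP ->.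
  by rewrite mulr0 addr0.
- by move=> x y; rewrite !unfold_in rmorphM mulf_eq0.
Qed.

Lemma prime_chain_eq (A : comNzRingType) k (P Q : {pred A}) :
  P =i Q -> prime_chain k P -> prime_chain k Q.
Proof.
by move=> eqPQ [C [prC ltC eqC]]; exists C; split=> // x; rewrite eqC eqPQ.
Qed.

Lemma prime_chain0 (A : comNzRingType) (P : {pred A}) :
  prime_ideal P -> prime_chain 0 P.
Proof. by exists (fun=> P). Qed.

Lemma prime_chainS (A : comNzRingType) k (P Q : {pred A}) x :
  prime_ideal Q -> {subset P <= Q} -> x \in Q -> x \notin P ->
  prime_chain k P -> prime_chain k.+1 Q.
Proof.
move=> prQ PQ Qx Px [C [prC ltC eqC]].
exists (fun i => if (i <= k)%N then C i else Q); split=> [i lei|i|].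
- by case: leqP => // lti; exact: prC.
- rewrite ltnS => lei; rewrite lei; case: ltnP => [lti|leki]; first exact: ltC.
  have -> : i = k by apply/eqP; rewrite eqn_leq lei.
  by split; [move=> y; rewrite eqC => /PQ|exists x => //; rewrite eqC].
- by rewrite ltnn.
Qed.

Lemma prime_chain_leq (A : comNzRingType) c k (P : {pred A}) :
  (c <= k)%N -> prime_chain k P -> prime_chain c P.
Proof.
move=> leck [C [prC ltC eqC]]; exists (fun i => C (i + (k - c))%N).
split=> [i lei|i lti|]; last by rewrite subnKC.
  by apply: prC; rewrite -[X in (_ <= X)%N](subnKC leck) leq_add2r.
by rewrite addSn; apply: ltC; rewrite -[X in (_ < X)%N](subnKC leck) ltn_add2r.
Qed.

Section ExistsChain.

Variables (K : fieldType) (n : nat) (P : {pred {mpoly K[n]}}).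

(* [Q i] is the kernel of [K[x] -> (K[x]/P)[x]] sending [x_j] to its class for
   [j < i] and to the variable [x_j] otherwise, so that [Q 0 = 0] and
   [Q n = P].  The variables at which the chain [Q] does not grow are
   independent modulo [P]. *)
Lemma exists_prime_chain : prime_ideal P ->
  exists k (Z : {set 'I_n}), [/\ (k + #|Z|)%N = n,
    indep_vars (fun x => x \in P) Z & prime_chain k P].
Proof.
move=> prP; have [D [f fP]] := prime_ideal_ker prP.
have [phi [phi0 phin phiS phi_free]] : exists phi :
    nat -> {rmorphism {mpoly K[n]} -> {mpoly D[n]}},
  [/\ forall p, phi 0%N p = 0 -> p = 0, forall p, phi n p = (f p)%:MP,
    forall i p, phi i p = 0 -> phi i.+1 p = 0
    & forall (i : 'I_n) p, (forall m, m \in msupp p -> m i = 0%N) ->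
        phi i.+1 p = phi i p].
  pose g : {rmorphism K -> {mpoly D[n]}} := @mpolyC n D \o f \o @mpolyC n K.
  pose var i (j : 'I_n) : {mpoly D[n]} :=
    if (j < i)%N then (f 'X_j)%:MP else 'X_j.
  pose phi i : {rmorphism {mpoly K[n]} -> {mpoly D[n]}} := mmap g (var i).
  exists phi; split=> [p|p|i p phip|i p pi].
  - pose fK : {rmorphism K -> D} := f \o @mpolyC n K.
    have phi0E : phi 0%N =1 map_mpoly fK.
      apply: (@mpoly_rmorph_eq _ _ _ (phi 0%N) (map_mpoly fK)) => [c|j].
        have -> : phi 0%N c%:MP = g c by exact: mmapC.
        by rewrite /map_mpoly [RHS]mmapC.
      by rewrite /map_mpoly [RHS]mmapX [LHS]mmapX !mmap1U.
    rewrite phi0E => /mpolyP phi0p; apply/mpolyP => m; have := phi0p m.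
    by rewrite !mcoeff0 mcoeff_map_mpoly => /eqP; rewrite fmorph_eq0 => /eqP.
  - apply: (@mpoly_rmorph_eq _ _ _ (phi n) (@mpolyC n D \o f)) => [c|j] /=.
      by rewrite mmapC.
    by rewrite mmapX mmap1U /var ltn_ord.
  (* Substituting the class of the next variable turns [phi i] into [phi i.+1]. *)
  - pose ev : {rmorphism {mpoly D[n]} -> {mpoly D[n]}} := mmap (@mpolyC n D)
      (fun j : 'I_n => if j == i :> nat then (f 'X_j)%:MP else 'X_j).
    suff -> : phi i.+1 p = (ev \o phi i) p by rewrite /= phip rmorph0.
    apply: mpoly_rmorph_eq => [c|j] /=; first by rewrite !mmapC /= ?mmapC.
    rewrite !mmapX !mmap1U /var ltnS leq_eqVlt.
    have [ji|ji] := ltnP j i; first by rewrite orbT mmapC.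
    by rewrite orbF mmapX mmap1U.
  - rewrite /= /mmap; apply: eq_big_seq => m /pi mi.
    congr (_ * _); apply: eq_bigr => j _; rewrite /var ltnS leq_eqVlt.
    by case: eqP => //= /val_inj ->; rewrite mi !expr0.
pose Q i : {pred {mpoly K[n]}} := fun p => phi i p == 0.
have QE i p : (p \in Q i) = (phi i p == 0) by [].
have prQ i : prime_ideal (Q i) by exact: rmorph_ker_prime.
have QS i : {subset Q i <= Q i.+1}.
  by move=> p; rewrite !QE => /eqP /phiS ->; rewrite eqxx.
(* The variables not yet substituted at stage [i] count as independent, along with [Z]. *)
pose bad i (Z : {set 'I_n}) := [set j : 'I_n | (j \in Z) || (i <= j)%N].
have main i : (i <= n)%N -> exists k (Z : {set 'I_n}),
    [/\ (k + #|Z|)%N = i, forall j, j \in Z -> (j < i)%N,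
      indep_vars (fun p => p \in Q i) (bad i Z) & prime_chain k (Q i)].
  elim: i => [_|i IHi lti].
    exists 0%N, set0; rewrite cards0; split=> //.
    - by move=> j; rewrite inE.
    - by move=> p _; rewrite QE => /eqP /phi0.
    - by apply: prime_chain0.
  have [k [Z [kZ ltZ indZ chZ]]] := IHi (ltnW lti).
  pose oi := Ordinal lti.
  have oiZ : oi \notin Z by apply/negP => /ltZ /=; rewrite ltnn.
  (* Each stage either leaves the ideal unchanged, and its variable joins [Z], or lengthens the
     chain. *)
  have [eqQ|neqQ] := pselect (forall p, p \in Q i.+1 -> p \in Q i).
    exists k, (oi |: Z); split.
    - by rewrite cardsU1 oiZ addnA addnAC kZ addn1.
    - by move=> j /setU1P[-> //|/ltZ /ltnW]; rewrite ltnS.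
    - move=> p pbad /eqQ; apply: indZ; apply: supp_inW pbad => m h j.
      rewrite inE negb_or -ltnNge => /andP[jZ ltji]; apply: h.
      rewrite !inE !negb_or jZ -ltnNge ltnS (ltnW ltji) !andbT.
      by apply/negP => /eqP ji; rewrite ji ltnn in ltji.
    - apply: prime_chain_eq chZ => p; apply/idP/idP; first exact: QS.
      exact: eqQ.
  have [p Qp nQp] : exists2 p, p \in Q i.+1 & p \notin Q i.
    apply: contrapT => nex; apply: neqQ => p Qp; apply: contrapT => /negP nQp.
    by apply: nex; exists p.
  exists k.+1, Z; split.
  - by rewrite addSn kZ.
  - by move=> j /ltZ /ltnW.
  (* A polynomial in [bad i.+1 Z] does not involve the variable [oi], so [phi i] and [phi i.+1]
     agree on it. *)
  - move=> q qbad Qq.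
    have qoi m : m \in msupp q -> m oi = 0%N.
      by move=> /qbad; apply; rewrite inE negb_or oiZ -ltnNge ltnS /=.
    apply: indZ.
      apply: supp_inW qbad => m h j; rewrite inE negb_or => /andP[jZ ltji].
      by apply: h; rewrite inE negb_or jZ /= -ltnNge ltnS ltnW // ltnNge.
    by move: Qq; rewrite !QE (phi_free oi q qoi).
  - exact: prime_chainS (prQ _) (QS _) Qp nQp chZ.
have [k [Z [kZ _ indZ chZ]]] := main n (leqnn n).
have eqQP : Q n =i P by move=> p; rewrite QE phin mpolyC_eq0 fP.
exists k, Z; split=> //; last exact: prime_chain_eq chZ.
move=> p pZ; rewrite -eqQP; apply: indZ; apply: supp_inW pZ => m h j.
by rewrite inE negb_or => /andP[jZ _]; apply: h.
Qed.

End ExistsChain.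

(** * Reduction modulo an ideal and local lengths *)

Section Reduction.

Variables (K : fieldType) (n : nat) (I : {mpoly K[n]} -> Prop).
Hypothesis idI : is_ideal I.
Implicit Types (S : 'X_{1..n} -> Prop) (p q : {mpoly K[n]}).

Definition red_to S p : Prop := exists2 q, supp_in S q & I (p - q).

Lemma idealZ a p : I p -> I (a *: p).
Proof. by rewrite -mul_mpolyC; exact: idealM. Qed.

Lemma red_to_supp S p : supp_in S p -> red_to S p.
Proof. by move=> Sp; exists p => //; rewrite subrr; exact: ideal0. Qed.

Lemma red_to_ideal S p : I p -> red_to S p.
Proof. by move=> Ip; exists 0; [exact: supp_in0|rewrite subr0]. Qed.

Lemma red_toW S S' p : (forall m, S m -> S' m) -> red_to S p -> red_to S' p.
Proof. by move=> SS' [q Sq Iq]; exists q => //; exact: supp_inW Sq. Qed.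

Lemma red_toD S p q : red_to S p -> red_to S q -> red_to S (p + q).
Proof.
move=> [p' Sp Ip] [q' Sq Iq]; exists (p' + q'); first exact: supp_inD.
by rewrite opprD addrACA; exact: idealD.
Qed.

Lemma red_toZ S a p : red_to S p -> red_to S (a *: p).
Proof.
move=> [q Sq Iq]; exists (a *: q); first exact: supp_inZ.
by rewrite -scalerBr; exact: idealZ.
Qed.

Lemma red_to_sum S (T : eqType) (s : seq T) (P : pred T) F :
  (forall i, i \in s -> P i -> red_to S (F i)) ->
  red_to S (\sum_(i <- s | P i) F i).
Proof.
elim: s => [|x s IHs] redF.
  by rewrite big_nil; apply: red_to_supp; exact: supp_in0.
have reds : red_to S (\sum_(i <- s | P i) F i).
  by apply: IHs => i si; apply: redF; rewrite inE si orbT.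
rewrite big_cons; case: ifP => // Px.
by apply: red_toD => //; apply: redF => //; rewrite mem_head.
Qed.

Lemma red_to_mnm S p :
  (forall m, m \in msupp p -> red_to S 'X_[m]) -> red_to S p.
Proof.
move=> redm; rewrite (mpolyE p); apply: red_to_sum => m /redm + _.
exact: red_toZ.
Qed.

Lemma red_to_trans S S' p :
  red_to S p -> (forall m, S m -> red_to S' 'X_[m]) -> red_to S' p.
Proof.
move=> [q Sq Iq] SS'; rewrite -(subrK q p); apply: red_toD.
  exact: red_to_ideal.
by apply: red_to_mnm => m /Sq /SS'.
Qed.

Lemma red_toMl S S' p q : red_to S p ->
  (forall m, S m -> red_to S' (q * 'X_[m])) -> red_to S' (q * p).
Proof.
move=> [r Sr Ir] SS'; rewrite -(subrK r p) mulrDr; apply: red_toD.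
  by apply: red_to_ideal; exact: idealM.
rewrite [X in q * X]mpolyE mulr_sumr; apply: red_to_sum => m /Sr /SS' + _.
by rewrite -scalerAr; exact: red_toZ.
Qed.

End Reduction.

Section Codimension.

Variables (K : fieldType) (n : nat).
Implicit Types (I : {mpoly K[n]} -> Prop) (p q : {mpoly K[n]}).

(* [I] plus the [s]-th power of the maximal ideal of the origin. *)
Definition truncation I (s : nat) : {mpoly K[n]} -> Prop :=
  red_to I (fun m => s <= mdeg m)%N.

Definition dim_mod_le (Q : {mpoly K[n]} -> Prop) (b : nat) : Prop :=
  exists (S : finType) (M : S -> {mpoly K[n]}),
    (#|S| <= b)%N /\ forall p, exists a : S -> K, Q (p - \sum_x a x *: M x).

Lemma dim_mod_leW Q b b' : (b <= b')%N -> dim_mod_le Q b -> dim_mod_le Q b'.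
Proof.
by move=> lebb' [S [M [leS spanM]]]; exists S, M; rewrite (leq_trans leS).
Qed.

Lemma truncation_mul I s p f : is_ideal I -> f@_0%MM = 0 ->
  truncation I s p -> truncation I s.+1 (p * f).
Proof.
move=> idI f0 [q sq Iq]; exists (q * f); last first.
  by rewrite -mulrBl mulrC; exact: idealM.
apply: supp_inM sq (_ : supp_in (fun m => 0 < mdeg m)%N f) => [m1 m2 h1 h2|m].
  by rewrite mdegD -addn1 leq_add.
rewrite mcoeff_msupp lt0n mdeg_eq0; apply: contra => /eqP ->.
by rewrite f0.
Qed.

(** Once reduced modulo [J], a polynomial is known modulo [I] up to a multiple [g * f]. Since [f]
    vanishes at the origin, [g] matters only up to order [s]. *)
Lemma dim_truncationS I J f s b b' : is_ideal I -> f@_0%MM = 0 ->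
  (forall p, J p -> exists g, I (p - g * f)) ->
  dim_mod_le (truncation J s.+1) b -> dim_mod_le (truncation I s) b' ->
  dim_mod_le (truncation I s.+1) (b + b').
Proof.
move=> idI f0 JI [S [M [leS spanM]]] [S' [M' [leS' spanM']]].
exists (S + S')%type,
  (fun x => match x with inl y => M y | inr y => M' y * f end).
split=> [|p]; first by rewrite card_sum leq_add.
have [a [q sq /JI[g Ig]]] := spanM p; have [a' Ia'] := spanM' g.
exists (fun x => match x with inl y => a y | inr y => a' y end).
rewrite big_sumType /=.
have -> : \sum_x a' x *: (M' x * f) = (\sum_x a' x *: M' x) * f.
  by rewrite mulr_suml; apply: eq_bigr => x _; rewrite scalerAl.
have := truncation_mul idI f0 Ia'; set u := \sum_x a' x *: M' x => trg.
set w := \sum_x a x *: M x in Ig *.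
have -> : p - (w + u * f) = (p - w - q - g * f) + (q + (g - u) * f) by ring.
apply: red_toD => //; first exact: red_to_ideal.
by apply: red_toD => //; exact: red_to_supp.
Qed.

Lemma dim_truncation0 I : is_ideal I -> dim_mod_le (truncation I 0) 0.
Proof.
move=> idI; exists void, (fun=> 0); rewrite card_void; split=> // p.
exists (fun=> 0); rewrite big_pred0 ?subr0; last by case.
exact: red_to_supp.
Qed.

(** Summing [dim_truncationS] over the orders up to [s]: removing one generator [f] raises the order
    of growth by at most one. *)
Lemma dim_truncation_growth I J f C k : is_ideal I -> f@_0%MM = 0 ->
  (forall p, J p -> exists g, I (p - g * f)) ->
  (forall s, dim_mod_le (truncation J s) (C * s.+1 ^ k)) ->
  forall s, dim_mod_le (truncation I s) (C * s.+1 ^ k.+1).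
Proof.
move=> idI f0 JI dimJ s.
suff : dim_mod_le (truncation I s) (s * (C * s.+1 ^ k)).
  apply: dim_mod_leW; rewrite mulnCA leq_mul2l expnS leq_mul2r leqnSn.
  by rewrite !orbT.
elim: s => [|s IHs]; first by rewrite mul0n; exact: dim_truncation0.
apply: dim_mod_leW (dim_truncationS idI f0 JI (dimJ s.+1) IHs).
by rewrite mulSn leq_add2l !leq_mul // leq_expn.
Qed.

(** The [t.+1 ^ n] monomials with exponents at most [t] have degree below [(n * t).+1], so they stay
    independent in that truncation. *)
Lemma dim_truncation_zero C k :
  (forall s, dim_mod_le (truncation (eq 0) s) (C * s.+1 ^ k)) -> (n <= k)%N.
Proof.
move=> dim0; apply: (@growth_le (C * 2 ^ k) n n k) => t.
have [S [M [leS spanM]]] := dim0 (n * t).+1.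
apply: leq_trans (_ : C * (n * t).+2 ^ k <= _)%N; last first.
  rewrite -mulnA leq_mul2l -expnMn leq_expn ?orbT //.
  by rewrite mul2n -addnn addSn addnS !ltnS leq_addr.
apply: leq_trans leS; rewrite leqNgt; apply/negP => ltS.
have id0 : is_ideal (eq (0 : {mpoly K[n]})).
  by split=> // [x y <- <-|a x <-]; rewrite ?addr0 ?mulr0.
have [|||||c [[f cf] [q sq qE]]] := @dependent_mod K _
  (truncation (eq 0) (n * t).+1) S
  (box (fun _ : 'I_n => t.+1)) M (fun f => 'X_[box_mnm f]).
- by apply: red_to_ideal => //.
- by move=> x y; exact: red_toD.
- by move=> a x; exact: red_toZ.
- by move=> f; exact: spanM.
- by rewrite card_box prod_nat_const card_ord.
move/eqP: qE; rewrite eq_sym subr_eq0 => /eqP qE.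
move/eqP: cf; apply; rewrite -(box_coef c) qE; apply: supp_in_coef0 sq _.
apply/negP; rewrite -leqNgt mdegE -[X in (_ <= X * _)%N]card_ord -sum_nat_const.
by apply: leq_sum => i _; rewrite mnmE -ltnS ltn_ord.
Qed.
End Codimension.

Lemma exists_subset_card (T : finType) (A : {set T}) (k : nat) :
  (k <= #|A|)%N -> exists2 B : {set T}, B \subset A & #|B| = k.
Proof.
move=> lek; exists [set x in take k (enum A)].
  by apply/subsetP => x; rewrite inE => /mem_take; rewrite mem_enum.
rewrite cardsE; have /card_uniqP -> := take_uniq k (enum_uniq A).
by rewrite size_takel // -cardE.
Qed.

Section IndependentVariables.

Variables (K : fieldType) (n : nat).
Implicit Types (I : {mpoly K[n]} -> Prop).

(* If no [k.+1] variables are independent modulo [I], the monomials that are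
   standard for the degree lexicographic order have at most [k] large
   exponents. *)
Lemma dim_truncation_dependent I k : is_ideal I ->
  (forall Z : {set 'I_n}, #|Z| = k.+1 -> ~ indep_vars I Z) ->
  exists C, forall s, dim_mod_le (truncation I s) (C * s.+1 ^ k).
Proof.
move=> idI depI.
have /choice[q qP] : forall Z : {set 'I_n}, exists q : {mpoly K[n]},
    #|Z| = k.+1 -> [/\ poly_in Z q, I q & q != 0].
  move=> Z; have [cZ|cZ] := pselect (#|Z| = k.+1); last by exists 0.
  by have [q qP] := not_indep_vars (depI Z cZ); exists q.
(* Larger than every exponent of every leading monomial, so [k.+1] exponents that reach [e] on [Z]
   make the leading monomial of [q Z] a divisor. *)
pose e := (\max_Z mdeg (mlead (q Z))).+1.
have lt_e Z i : (mlead (q Z) i < e)%N.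
  rewrite ltnS (leq_trans _ (leq_bigmax Z)) // mdegE (bigD1 i) //=.
  exact: leq_addr.
pose large (m : 'X_{1..n}) := [set i | (e <= m i)%N].
have red_std m : red_to I
    (fun m' => mdeg m' <= mdeg m /\ #|large m'| <= k)%N 'X_[m].
  elim/(well_founded_induction (@ltom_wf n)): m => m IHm.
  have [lek|ltk] := leqP #|large m| k.
    by apply: red_to_supp => //; apply: supp_inX.
  have [Z Zm cZ] : exists2 Z : {set 'I_n}, Z \subset large m & #|Z| = k.+1.
    exact: exists_subset_card.
  have [qZ Iq q0] := qP Z cZ.
  have lem : (mlead (q Z) <= m)%MM.
    apply/mnm_lepP => i; have [iZ|iZ] := boolP (i \in Z).
      have := subsetP Zm _ iZ; rewrite inE; apply: leq_trans.
      exact: ltnW.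
    by rewrite (qZ _ (mlead_supp q0)).
  set a := (q Z)@_(mlead (q Z)).
  have a0 : a != 0 by rewrite mleadc_eq0.
  set d := (m - mlead (q Z))%MM.
  have dm : (d + mlead (q Z))%MM = m by rewrite submK.
  have -> : 'X_[m] = a^-1 *: ('X_[d] * q Z) -
      a^-1 *: ('X_[d] * (q Z - a *: 'X_[mlead (q Z)])) :> {mpoly K[n]}.
    rewrite -scalerBr -mulrBr opprB addrC subrK -scalerAr scalerA mulVf //.
    by rewrite scale1r -mpolyXD dm.
  apply: red_toD => //.
    by apply: red_to_ideal; apply: idealZ => //; exact: idealM.
  rewrite -scaleN1r scalerA; apply: red_toZ => //; apply: red_to_mnm => //.
  move=> m' /msuppM_le /allpairsP[[m1 m2] /= [+ m2q ->]].
  rewrite msuppX inE => /eqP ->.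
  have m2q' : m2 \in msupp (q Z).
    move: m2q; rewrite !mcoeff_msupp mcoeffB mcoeffZ mcoeffX.
    case: (mlead (q Z) =P m2) => [<-|_]; first by rewrite /= mulr1 subrr eqxx.
    by rewrite mulr0 subr0.
  have ne_m2 : m2 != mlead (q Z).
    apply: contraTneq m2q => ->.
    by rewrite mcoeff_msupp mcoeffB mcoeffZ mcoeffX eqxx /= mulr1 subrr eqxx.
  have lt_m : ((d + m2)%MM < m)%O.
    by rewrite -dm ltmc_add2r Order.POrderTheory.lt_neqAle ne_m2 msupp_le_mlead.
  apply: red_toW (IHm _ lt_m) => m'' [ledeg lel]; split=> //.
  by apply: leq_trans ledeg _; apply: lemc_mdeg; apply: Order.POrderTheory.ltW.
(* The two factors count the positions of the large exponents and the values of the small ones; the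
   at most [k] large values give [s.+1 ^ k]. *)
exists (2 ^ n * e ^ n)%N => s.
pose S := ({set 'I_n} * {ffun 'I_n -> 'I_e} * k.-tuple 'I_s.+1)%type.
pose g (x : S) : 'X_{1..n} := [multinom
  if i \in x.1.1 then nth ord0 x.2 (index i (enum x.1.1)) : nat
  else x.1.2 i : nat | i < n].
have g_surj m : (mdeg m <= s)%N /\ (#|large m| <= k)%N -> exists x, g x = m.
  (* The large exponents in the order of [enum], padded with zeros to length [k]. *)
  move=> [degm largem]; pose x0 : seq 'I_s.+1 :=
    [seq inord (m i) | i <- enum (large m)] ++ nseq (k - #|large m|) ord0.
  have sz : size x0 == k.
    by rewrite size_cat size_nseq size_map -cardE subnKC.
  exists (large m, [ffun i => inord (m i)], Tuple sz); apply/mnmP => i.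
  rewrite mnmE /= ffunE.
  have lemi : (m i <= s)%N.
    by apply: leq_trans degm; rewrite mdegE (bigD1 i) //= leq_addr.
  case: ifPn => [il|]; last by rewrite inE -ltnNge => lti; rewrite inordK.
  have szi : (index i (enum (large m)) < size (enum (large m)))%N.
    by rewrite index_mem mem_enum.
  rewrite nth_cat size_map szi (nth_map i) // nth_index ?mem_enum //.
  by rewrite inordK.
exists S, (fun x => 'X_[g x]); split.
  rewrite !card_prod card_tuple card_ffun !card_ord -cardsT.
  by rewrite -powersetT card_powerset cardsT card_ord.
move=> p.
have [r rS Ir] : red_to I (fun m => s <= mdeg m \/
    (mdeg m <= s /\ #|large m| <= k))%N p.
  apply: red_to_mnm => // m _; case: (leqP s (mdeg m)) => [les|lts].
    by apply: red_to_supp => //; apply: supp_inX; left.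
  apply: red_toW (red_std m) => m' [h1 h2]; right; split=> //.
  exact: leq_trans h1 (ltnW lts).
pose r1 := \sum_(m <- msupp r | (s <= mdeg m)%N) r@_m *: 'X_[m].
pose r2 := \sum_(m <- msupp r | ~~ (s <= mdeg m)%N) r@_m *: 'X_[m].
have rE : r = r1 + r2 by rewrite {1}(mpolyE r) (bigID (fun m => s <= mdeg m)%N).
have [|a aE] := @supp_in_span _ _ _ g r2.
  rewrite /r2 => m /msupp_sum_le /flatten_mapP[m']; rewrite mem_filter.
  move=> /andP[nsm /rS[|m'P /msuppZ_le]]; first by rewrite (negbTE nsm).
  by rewrite msuppX inE => /eqP ->; exact: g_surj.
exists a; rewrite -aE; exists r1.
  by apply: supp_in_sum => m sm; apply: supp_inZ; exact: supp_inX.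
by rewrite -addrA -opprD [r2 + r1]addrC -rE.
Qed.

Variables (c : nat) (f : 'I_c -> {mpoly K[n]}).
Hypothesis f0 : forall i, (f i)@_0%MM = 0.

Let sub_ideal j := gen_ideal (fun q => exists i : 'I_c, (i < j)%N /\ q = f i).

(** Otherwise the truncations grow with order at most [n - c - 1]; removing the [c] generators one
    by one would give the zero ideal order at most [n - 1]. *)
Lemma exists_indep_vars : (c <= n)%N -> exists Z : {set 'I_n},
  #|Z| = (n - c)%N /\ indep_vars (gen_ideal (fun q => exists i, q = f i)) Z.
Proof.
move=> lecn; apply: contrapT => nex.
have depI (Z : {set 'I_n}) : #|Z| = (n - c)%N ->
    ~ indep_vars (gen_ideal (fun q => exists i, q = f i)) Z.
  by move=> cZ indZ; apply: nex; exists Z.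
have idI := gen_ideal_is_ideal (fun q => exists i, q = f i).
case Em : (n - c)%N => [|k].
  (* When [c = n], dependence of the empty set means a nonzero constant in the ideal, whose elements
     all vanish at the origin. *)
  have c0 : #|set0 : {set 'I_n}| = (n - c)%N by rewrite cards0 Em.
  have [q [qP Iq q0]] := not_indep_vars (depI set0 c0).
  have Ic0 p : gen_ideal (fun q => exists i, q = f i) p -> p@_0%MM = 0.
    move=> [l [a [g [gP ->]]]]; rewrite raddf_sum big1 // => i _.
    by have [j ->] := gP i; rewrite /= rmorphM /= f0 mulr0.
  move/eqP: q0; apply; apply/mpolyP => m; rewrite mcoeff0.
  have [->|m0] := eqVneq m 0%MM; first exact: Ic0.
  apply: supp_in_coef0 qP _ => hm; move/eqP: m0; apply.
  by apply/mnmP => i; rewrite hm ?inE // mnm0E.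
have id_sub j : is_ideal (sub_ideal j) by exact: gen_ideal_is_ideal.
have main d : (d <= c)%N -> exists C, forall s,
    dim_mod_le (truncation (sub_ideal (c - d)) s) (C * s.+1 ^ (k + d)).
  elim: d => [_|d IHd ltd].
    rewrite subn0 addn0; apply: dim_truncation_dependent => // Z cZ indZ.
    apply: (depI Z); first by rewrite Em.
    move=> p pZ Ip; apply: indZ => //; apply: gen_ideal_sub Ip => // _ [i ->].
    by apply: mem_gen_ideal; exists i.
  have [C dimC] := IHd (ltnW ltd); exists C; rewrite addnS.
  have lt_cd : (c - d.+1 < c)%N by rewrite ltn_subrL (leq_trans _ ltd).
  apply: (@dim_truncation_growth _ _ _ _ (f (Ordinal lt_cd)) _ _ _ (f0 _) _ dimC).
    exact: id_sub.
  apply: gen_ideal_sub.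
    split=> [|x y [u xu] [v yv]|a x [u xu]].
    - by exists 0; rewrite mul0r subr0; exact: ideal0.
    - by exists (u + v); rewrite mulrDl opprD addrACA; exact: idealD.
    - by exists (a * u); rewrite -mulrA -mulrBr; exact: idealM.
  move=> _ [i [lti ->]]; have [ei|nei] := eqVneq i (Ordinal lt_cd).
    by exists 1; rewrite ei mul1r subrr; exact: ideal0.
  exists 0; rewrite mul0r subr0; apply: mem_gen_ideal; exists i; split=> //.
  rewrite ltn_neqAle -ltnS subnSK // lti andbT.
  by apply: contraNneq nei => ei; apply/eqP/val_inj.
have [C dimC] := main c (leqnn c).
have := @dim_truncation_zero K n C (k + c).
have -> : (n <= k + c)%N = false.
  by rewrite -(subnK lecn) Em addSn ltnn.
suff h : forall s,
    dim_mod_le (truncation (eq (0 : {mpoly K[n]})) s) (C * s.+1 ^ (k + c)).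
  by move=> /(_ h).
move=> s; have [S [M [leS spanM]]] := dimC s; exists S, M; split=> // p.
have [a [q sq Iq]] := spanM p; exists a, q => //.
move: Iq; rewrite subnn => -[l [b [g [gP ->]]]].
by rewrite big1 // => i _; have [j []] := gP i.
Qed.

End IndependentVariables.

(** * A criterion for codimension [c] through independent variables *)

Section CodimCriterion.

Variables (K : fieldType) (n c : nat) (f : 'I_c -> {mpoly K[n]}).

Lemma indep_varsW (I J : {mpoly K[n]} -> Prop) (Z Y : {set 'I_n}) :
  (forall x, I x -> J x) -> Y \subset Z -> indep_vars J Z -> indep_vars I Y.
Proof.
move=> IJ /subsetP YZ indZ p pY /IJ; apply: indZ.
by apply: supp_inW pY => m h i iZ; apply: h; apply: contraNN iZ => /YZ.
Qed.

(** Lower bound: [exists_prime_chain] at a prime of smaller height would leave too many independent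
    variables. Upper bound: a prime keeping [n - c] variables independent, by [prime_chain_le]. *)
Lemma codim_gen_ideal : (c <= n)%N -> (forall i, (f i)@_0%MM = 0) ->
  (forall Z : {set 'I_n}, #|Z| = (n - c).+1 ->
    ~ indep_vars (gen_ideal (fun q => exists i, q = f i)) Z) ->
  codim (gen_ideal (fun q => exists i, q = f i)) c.
Proof.
move=> lecn f0 dep; split.
  move=> P prP IP; have [k [Z [kZ indZ chP]]] := exists_prime_chain prP.
  apply: prime_chain_leq chP; rewrite leqNgt; apply/negP => ltkc.
  have [|Y YZ cY] := @exists_subset_card _ Z (n - c).+1.
    by rewrite -(addKn k #|Z|) kZ ltn_sub2l // (leq_trans ltkc).
  by apply: (dep Y cY); apply: indep_varsW indZ.
have [Z [cZ indZ]] := exists_indep_vars f0 lecn.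
have [P [prP IP indP]] := exists_prime_indep (gen_ideal_is_ideal _) indZ.
exists P; split=> // k /(prime_chain_le indP).
by rewrite cZ => le_n; rewrite -(leq_add2r (n - c)) subnKC.
Qed.

End CodimCriterion.

(** * Quasi-stable ideals and Pommaret reduction *)

Section QuasiStable.

Variables (K : fieldType) (n : nat) (J : {mpoly K[n]} -> Prop).
Hypotheses (J1 : ~ J 1) (qsJ : quasi_stable J).

Lemma mnm_eq0P (m : 'X_{1..n}) : m <> 0%MM -> exists i, (0 < m i)%N.
Proof.
move=> m0; apply: contrapT => nex; apply: m0; apply/mnmP => i.
rewrite mnm0E; apply/eqP; rewrite -leqn0 leqNgt; apply/negP => mi.
by apply: nex; exists i.
Qed.

Lemma exists_min_var (m : 'X_{1..n}) :
  m <> 0%MM -> exists i, is_min_var m i.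
Proof.
move=> /mnm_eq0P[i0 mi0].
case: (@arg_minnP _ i0 (fun i => 0 < m i)%N (fun i => i : nat) mi0).
by move=> i mi le_i; exists i.
Qed.

Lemma exists_max_var (m : 'X_{1..n}) :
  m <> 0%MM -> exists i, is_max_var m i.
Proof.
move=> /mnm_eq0P[i0 mi0].
case: (@arg_maxnP _ i0 (fun i => 0 < m i)%N (fun i => i : nat) mi0).
by move=> i mi le_i; exists i.
Qed.

Lemma min_var_uniq (m : 'X_{1..n}) i j :
  is_min_var m i -> is_min_var m j -> i = j.
Proof.
move=> [mi hi] [mj hj]; apply/val_inj/eqP.
by rewrite eqn_leq hi // hj.
Qed.

(** Quasi-stability trades one factor of the smallest variable for a power of the variable [k]; the
    total exponent off [k] drops until a pure power remains. *)
Lemma pure_power_max_var (m : 'X_{1..n}) k : J 'X_[m] -> is_max_var m k ->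
  exists d, J 'X_[U_(k) *+ d].
Proof.
move=> Jm [_ maxk]; have {maxk} : forall j : 'I_n, (k < j)%N -> m j = 0%N.
  by move=> j; case: (posnP (m j)) => // /maxk; rewrite leqNgt => /negP.
have [w lew] := ubnP (\sum_(j | j != k) m j)%N.
elim: w m lew Jm => // w IHw m lew Jm maxk.
have [s0|s0] := posnP (\sum_(j | j != k) m j)%N.
  exists (m k); suff -> : (U_(k) *+ m k)%MM = m by [].
  apply/mnmP => j; rewrite mulmnE mnm1E.
  have [->|nj] := eqVneq k j; first by rewrite mul1n.
  move: s0; rewrite (bigD1 j) 1?eq_sym //= => /eqP.
  by rewrite addn_eq0 => /andP[/eqP ->].
have [j nj mj] : exists2 j, j != k & (0 < m j)%N.
  apply: contrapT => nex; move: s0; rewrite lt0n => /eqP; apply.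
  apply: big1 => j nj; apply/eqP; rewrite -leqn0 leqNgt; apply/negP => mj.
  by apply: nex; exists j.
have [i mini] : exists i, is_min_var m i.
  by apply: exists_min_var => m0; rewrite m0 mnm0E in mj.
have ltjk : (j < k)%N.
  by rewrite ltn_neqAle nj /= leqNgt; apply/negP => /maxk m0; rewrite m0 in mj.
have ltik : (i < k)%N by apply: leq_ltn_trans ltjk; apply: mini.2.
have nik : i != k by apply: contraTneq ltik => ->; rewrite ltnn.
have [s Js] := qsJ.2 m i k Jm mini ltik.
apply: IHw Js _ => [|l ltkl].
  rewrite -ltnS; apply: leq_trans lew; rewrite ltnS.
  rewrite (bigD1 i) //= [X in (_ <= X)%N](bigD1 i) //= -addSn leq_add //.
    rewrite mnmDE mnmBE mulmnE !mnm1E eqxx eq_sym (negbTE nik) mul0n addn0.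
    by rewrite subn1 prednK //; case: mini.
  apply: leq_sum => l /andP[lk li]; rewrite mnmDE mnmBE mulmnE !mnm1E.
  by rewrite ![k == l]eq_sym (negbTE lk) mul0n addn0 leq_subr.
rewrite mnmDE mnmBE mulmnE !mnm1E maxk // sub0n.
have -> : (k == l) = false by apply/eqP => kl; rewrite kl ltnn in ltkl.
by rewrite mul0n.
Qed.

Definition pure_power_vars : {set 'I_n} :=
  [set k | `[< exists d, J 'X_[U_(k) *+ d] >]].

Lemma pure_power_dvd (m : 'X_{1..n}) : J 'X_[m] ->
  exists2 k, k \in pure_power_vars & (0 < m k)%N.
Proof.
move=> Jm; have m0 : m <> 0%MM by move=> m0; apply: J1; rewrite -mpolyX0 -m0.
have [k mk] := exists_max_var m0; exists k; last by case: mk.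
by rewrite inE; apply/asboolP; apply: pure_power_max_var mk.
Qed.

(** [J] lies in the kernel of setting these variables to zero. The other variables are independent
    modulo this prime, which bounds its height. *)
Lemma codim_le_pure_powers c : codim J c -> (c <= #|pure_power_vars|)%N.
Proof.
move=> [codJ _]; set T := pure_power_vars.
pose phi : {rmorphism {mpoly K[n]} -> {mpoly K[n]}} :=
  mmap (@mpolyC n K) (fun k => if k \in T then 0 else 'X_k).
have phi_id p : poly_in (~: T) p -> phi p = p.
  move=> pT; rewrite [RHS]mpolyE /= /mmap; apply: eq_big_seq => m /pT m0.
  rewrite mul_mpolyC mpolyXE_id; congr (_ *: _); apply: eq_bigr => i _.
  by case: ifP => // iT; rewrite m0 ?expr0 // inE iT.
have prT := rmorph_ker_prime phi.
have [|C chP] := codJ _ prT.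
  move=> p; have [T0 JT0] := qsJ.1; rewrite JT0.
  apply: (gen_ideal_sub (prime_ideal_is_ideal prT)).
  move=> _ [m T0m ->]; have [|k kT mk] := @pure_power_dvd m.
    by rewrite JT0; apply: mem_gen_ideal; exists m.
  rewrite unfold_in /= mmapX /mmap1 (bigD1 k) //= kT expr0n.
  by rewrite eqn0Ngt mk mul0r.
have := @prime_chain_le _ _ _ (~: T) c _ (ex_intro _ C chP).
rewrite cardsCs setCK card_ord => le_n.
have leTn : (#|T| <= n)%N by rewrite -[X in (_ <= X)%N]card_ord max_card.
rewrite -(leq_add2r (n - #|T|)) (subnKC leTn); apply: le_n => p pT.
by rewrite unfold_in phi_id // => /eqP.
Qed.

End QuasiStable.

Section Weight.

Variable n : nat.
Implicit Types m : 'X_{1..n}.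

(* Comparing weights in a large base is comparing lexicographically from the
   last variable. *)
Definition mnm_weight q m : nat := (\sum_(i < n) m i * q ^ i)%N.

Lemma digits_lt q m l : (0 < q)%N -> (forall i, m i < q)%N ->
  (\sum_(i < n | i < l) m i * q ^ i < q ^ l)%N.
Proof.
move=> q0 ltq; elim: l => [|l IHl]; first by rewrite big_pred0.
have [lenl|ltln] := leqP n l.
  rewrite (eq_bigl (fun i : 'I_n => i < l)%N) => [|i]; last first.
    by rewrite !(leq_trans (ltn_ord i)) // ltnW.
  by apply: leq_trans IHl _; rewrite leq_pexp2l.
rewrite (bigD1 (Ordinal ltln)) //=.
rewrite (eq_bigl (fun i : 'I_n => i < l)%N) => [|i]; last first.
  by rewrite -(inj_eq val_inj) /= ltnS [RHS]ltn_neqAle andbC.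
apply: leq_trans (_ : (m (Ordinal ltln)).+1 * q ^ l <= _)%N.
  by rewrite mulSn addnC ltn_add2r.
by rewrite expnS leq_mul2r ltq orbT.
Qed.

Lemma mnm_weight_lt q m m' (l : 'I_n) : (forall i, m i < q)%N ->
  (forall i : 'I_n, (l < i)%N -> m i = 0%N) ->
  (m l < m' l)%N \/ (exists2 i : 'I_n, (l < i)%N & (0 < m' i)%N) ->
  (mnm_weight q m < mnm_weight q m')%N.
Proof.
move=> ltq m0 ltm; have q0 : (0 < q)%N by apply: leq_ltn_trans (ltq l).
have ltw : (mnm_weight q m < (m l).+1 * q ^ l)%N.
  rewrite /mnm_weight (bigID (fun i : 'I_n => i < l)%N) /= mulSn.
  rewrite [X in (_ + X)%N](bigD1 l) ?ltnn //=.
  rewrite [X in (_ + (_ + X))%N]big1 => [|i].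
    by rewrite addn0 ltn_add2r digits_lt.
  rewrite -leqNgt => /andP[leli nli]; rewrite m0 ?mul0n //.
  by rewrite ltn_neqAle leli andbT eq_sym.
apply: leq_trans ltw _; case: ltm => [ltl|[i ltli m'i]].
  rewrite /mnm_weight (bigD1 l) //=; apply: leq_trans (leq_addr _ _).
  by rewrite leq_mul2r ltl orbT.
rewrite /mnm_weight (bigD1 i) //=; apply: leq_trans (leq_addr _ _).
apply: leq_trans (_ : q ^ l.+1 <= _)%N.
  by rewrite expnS leq_mul2r ltq orbT.
apply: leq_trans (leq_pmull _ m'i).
by rewrite leq_pexp2l.
Qed.

End Weight.

Section Pommaret.

Variables (K : fieldType) (n t : nat) (J : {mpoly K[n]} -> Prop).
Variables (P : t.-tuple 'X_{1..n}) (h : 'I_t -> {mpoly K[n]}).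
Hypotheses (J1 : ~ J 1) (qsJ : quasi_stable J).
Hypotheses (pomP : pommaret_basis J P) (markedh : marked_set J P h).

Lemma pommaret_ideal : is_ideal J.
Proof.
have [T JT] := qsJ.1.
have idT := gen_ideal_is_ideal (fun q => exists2 m, T m & q = 'X_[m]).
split; first by rewrite JT; exact: ideal0.
  by move=> x y; rewrite !JT; exact: idealD.
by move=> a x; rewrite !JT; exact: idealM.
Qed.

Let idJ := pommaret_ideal.

Lemma pommaret_mem j : J 'X_[tnth P j].
Proof.
rewrite (proj1 pomP); apply: mem_gen_ideal.
by exists (tnth P j); rewrite ?mem_tnth.
Qed.

Lemma ideal_mnm_dvd (m m' : 'X_{1..n}) : J 'X_[m] -> (m <= m')%MM -> J 'X_[m'].
Proof. by move=> Jm /submK <-; rewrite mpolyXD; exact: idealM. Qed.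

Lemma pommaret_decomp (m : 'X_{1..n}) : J 'X_[m] -> exists j d,
  m = (d + tnth P j)%MM /\
  forall i k, is_max_var d i -> is_min_var (tnth P j) k -> (i <= k)%N.
Proof.
move=> Jm; have [mP|mP] := boolP (m \in P).
  have [j ->] := tnthP P m mP; exists j, 0%MM; rewrite add0m; split=> // i k [].
  by rewrite mnm0E.
have [u [[uP [d [md hd]]] _]] := proj2 pomP m Jm mP.
by have [j uj] := tnthP P u uP; exists j, d; rewrite -uj.
Qed.

Lemma pommaret_neq0 j : tnth P j <> 0%MM.
Proof. by move=> P0; have := pommaret_mem j; rewrite P0 mpolyX0. Qed.

Lemma marked_head j : tnth P j \in msupp (h j).
Proof.
by rewrite mcoeff_msupp; have [_ -> _] := markedh j; rewrite oner_neq0.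
Qed.

Lemma marked_mdeg j m : m \in msupp (h j) -> mdeg m = mdeg (tnth P j).
Proof.
have [[d /dhomogP hd] _ _] := markedh j => mh.
by rewrite (hd _ mh) (hd _ (marked_head j)).
Qed.

Lemma marked_coef0 j : (h j)@_0%MM = 0.
Proof.
apply: memN_msupp_eq0; apply/negP => /marked_mdeg; rewrite mdeg0 => /esym/eqP.
by rewrite mdeg_eq0 => /eqP; exact: pommaret_neq0.
Qed.

(* Rewriting [x^d h_j] replaces the multiplicative factor [d] by smaller ones. *)
Lemma pommaret_weight_lt (d g d' : 'X_{1..n}) j q :
  (d + g = d' + tnth P j)%MM -> ~ J 'X_[g] ->
  (forall i k, is_max_var d' i -> is_min_var (tnth P j) k -> (i <= k)%N) ->
  (forall i, d' i < q)%N -> (mnm_weight q d' < mnm_weight q d)%N.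
Proof.
move=> /mnmP dg nJg mult ltq.
have [l minl] := exists_min_var (@pommaret_neq0 j).
have d'0 (i : 'I_n) : (l < i)%N -> d' i = 0%N.
  case: (posnP (d' i)) => // d'i ltli.
  have [|k maxk] := @exists_max_var _ d'.
    by move=> d'0; rewrite d'0 mnm0E in d'i.
  have := leq_trans (maxk.2 _ d'i) (mult _ _ maxk minl).
  by rewrite leqNgt ltli.
apply: (@mnm_weight_lt _ q d' d l) => //.
have [[i ltli di]|nd] := pselect (exists2 i : 'I_n, (l < i)%N & (0 < d i)%N).
  by right; exists i.
(* Otherwise the head term divides [g]: it has no variable below [l], above [l] both [d] and [d']
   vanish, and at [l] the inequality [led] compares exponents. *)
left; rewrite ltnNge; apply/negP => led; apply: nJg.
apply: (ideal_mnm_dvd (pommaret_mem j)); apply/mnm_lepP => i.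
have := dg i; rewrite !mnmDE; case: (ltngtP i l) => [ltil|ltli|/val_inj ->].
- have -> : tnth P j i = 0%N; last by [].
  case: (posnP (tnth P j i)) => // /(minl.2).
  by rewrite leqNgt ltil.
- rewrite d'0 // add0n => <-; case: (posnP (d i)) => [-> //|di].
  by case: nd; exists i.
- by move=> e; rewrite -(leq_add2l (d l)) e leq_add2r.
Qed.

Definition degree_in (A : {set 'I_n}) (m : 'X_{1..n}) : nat :=
  (\sum_(i in A) m i)%N.

Lemma degree_inD (A : {set 'I_n}) (m m' : 'X_{1..n}) :
  degree_in A (m + m')%MM = (degree_in A m + degree_in A m')%N.
Proof. by rewrite -big_split; apply: eq_bigr => i _; rewrite mnmDE. Qed.

Lemma degree_in_lt (A : {set 'I_n}) (m : 'X_{1..n}) i :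
  i \notin A -> (0 < m i)%N ->
  (degree_in A m < mdeg m)%N.
Proof.
move=> iA mi; rewrite mdegE [X in (_ < X)%N](bigID (mem A)) /= -addn1 leq_add2l.
by rewrite (bigD1 i) //= ltn_addr.
Qed.

(** A monomial in [A] of degree at least [D] lies in [J] and can be rewritten by marked polynomials
    in [I]. Degree is preserved, so the process stops only when a variable outside [A] appears,
    which lowers the degree in [A]. *)
Lemma marked_reduction : exists2 D, (0 < D)%N & forall (A : {set 'I_n})
    (I : {mpoly K[n]} -> Prop),
  A \subset pure_power_vars J -> is_ideal I ->
  (forall j k, is_min_var (tnth P j) k -> k \in A -> I (h j)) ->
  forall m, red_to I
    (fun m' => mdeg m' = mdeg m /\ (degree_in A m' < D)%N) 'X_[m].
Proof.
have /choice[d dP] : forall k, exists d, k \in pure_power_vars J ->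
    J 'X_[U_(k) *+ d].
  move=> k; have [|] := boolP (k \in pure_power_vars J); last by exists 0%N.
  by rewrite inE => /asboolP[d Jd]; exists d.
exists (\sum_k d k).+1 => // A I AT idI Ih; set D := (\sum_k d k).+1.
(* Pigeonhole: degree above the sum of the [d k] forces some exponent in [A] to reach [d i]. *)
have inJ (m : 'X_{1..n}) :
    (forall i, i \notin A -> m i = 0%N) -> (D <= mdeg m)%N -> J 'X_[m].
  move=> mA leD; have [i [iA led]] : exists i, i \in A /\ (d i <= m i)%N.
    apply: contrapT => nex; move: leD; rewrite /D ltnNge => /negP; apply.
    rewrite mdegE; apply: leq_sum => i _; have [iA|/mA -> //] := boolP (i \in A).
    by rewrite ltnW // ltnNge; apply/negP => led; apply: nex; exists i.
  apply: (ideal_mnm_dvd (dP i (subsetP AT _ iA))); apply/mnm_lepP => k.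
  by rewrite mulmnE mnm1E; case: eqP => [<-|_]; rewrite ?mul1n ?mul0n.
have in_A (m : 'X_{1..n}) i :
    (forall k, k \notin A -> m k = 0%N) -> (0 < m i)%N -> i \in A.
  by move=> mA; apply: contraTT => /mA ->.
have red_top e : (D <= e)%N -> forall m : 'X_{1..n},
    (forall i, i \notin A -> m i = 0%N) ->
    mdeg m = e ->
    red_to I (fun m' => mdeg m' = e /\ (degree_in A m' < e)%N) 'X_[m].
  move=> leD.
  (* Induction on the weight of the multiplier [dl]; the base [e.+1] exceeds all exponents occurring
     in degree [e]. *)
  have main w dl j : (mnm_weight e.+1 dl < w)%N ->
      (forall i, i \notin A -> (dl + tnth P j)%MM i = 0%N) ->
      mdeg (dl + tnth P j)%MM = e ->
      red_to I (fun m' => mdeg m' = e /\ (degree_in A m' < e)%N)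
        'X_[dl + tnth P j].
    elim: w dl j => // w IHw dl j ltw mA dege.
    have -> : 'X_[dl + tnth P j] = 'X_[dl] * h j +
        (- 1) *: ('X_[dl] * (h j - 'X_[tnth P j])) :> {mpoly K[n]}.
      by rewrite scaleN1r mulrBr opprB addrC subrK mpolyXD.
    apply: red_toD => //.
      apply: red_to_ideal; apply: idealM => //.
      have [k mink] := exists_min_var (@pommaret_neq0 j).
      apply: (Ih j k mink); apply: (in_A _ _ mA).
      by rewrite mnmDE ltn_addl //; case: mink.
    apply: red_toZ => //; apply: red_to_mnm => // m.
    move=> /msuppM_le /allpairsP[[m1 m2] /= [+ + ->]].
    rewrite msuppX inE => /eqP -> m2h.
    have [m2P|nm2P] := eqVneq m2 (tnth P j).
      move: m2h; rewrite m2P mcoeff_msupp mcoeffB mcoeffX eqxx.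
      by have [_ -> _] := markedh j; rewrite subrr eqxx.
    have m2h' : m2 \in msupp (h j).
      move: m2h; rewrite !mcoeff_msupp mcoeffB mcoeffX.
      by rewrite [_ == m2]eq_sym (negbTE nm2P) subr0.
    have nJ2 : ~ J 'X_[m2] by have [_ _] := markedh j; apply.
    have deg2 : mdeg (dl + m2)%MM = e.
      by rewrite mdegD (marked_mdeg m2h') -mdegD.
    (* A term with a variable outside [A] is already reduced; any other lies in [J] again and has a
       multiplier of smaller weight. *)
    have [[i iA mi]|nout] := pselect
        (exists2 i, i \notin A & (0 < (dl + m2)%MM i)%N).
      apply: red_to_supp => //; apply: supp_inX; split=> //.
      by rewrite -deg2; apply: degree_in_lt mi.
    have m2A i : i \notin A -> (dl + m2)%MM i = 0%N.
      move=> iA; case: (posnP ((dl + m2)%MM i)) => // mi.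
      by case: nout; exists i.
    have [|j' [d' [dE mult]]] := @pommaret_decomp (dl + m2)%MM.
      by apply: inJ => //; rewrite deg2.
    rewrite dE; apply: IHw; rewrite -?dE //.
    apply: leq_trans (_ : mnm_weight e.+1 dl <= _)%N => //.
    apply: (pommaret_weight_lt dE nJ2 mult) => i.
    rewrite ltnS -deg2 dE mdegD mdegE (bigD1 i) //= -addnA.
    exact: leq_addr.
  move=> m mA dege; have [|j [dl [mE _]]] := @pommaret_decomp m.
    by apply: inJ => //; rewrite dege.
  by rewrite mE; apply: (main _.+1) => //; rewrite -mE.
move=> m; have [w] := ubnP (degree_in A m).
elim: w m => // w IHw m ltw.
have [leD|ltD] := leqP D (degree_in A m); last first.
  by apply: red_to_supp => //; apply: supp_inX.
(* Only the part of [m] in [A] is rewritten; the rest is carried along as a factor. *)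
pose tau := [multinom if i \in A then m i else 0%N | i < n].
pose rho := [multinom if i \in A then 0%N else m i | i < n].
have mE : m = (rho + tau)%MM.
  by apply/mnmP => i; rewrite mnmDE !mnmE; case: ifP; rewrite ?addn0.
have rhoA : degree_in A rho = 0%N.
  by apply: big1 => i iA; rewrite mnmE iA.
have tauA : mdeg tau = degree_in A m.
  rewrite mdegE /degree_in [RHS]big_mkcond; apply: eq_bigr => i _.
  by rewrite mnmE.
rewrite {2}mE mpolyXD.
apply: red_toMl (red_top _ leD tau _ tauA) _ => //.
  by move=> i iA; rewrite mnmE (negbTE iA).
move=> m' [degm' ltm']; rewrite -mpolyXD.
apply: red_toW (IHw (rho + m')%MM _) => [m'' [-> ?]|].
  by split=> //; rewrite [in RHS]mE !mdegD degm' tauA.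
by rewrite degree_inD rhoA add0n (leq_trans ltm').
Qed.

End Pommaret.

(** * Generic combinations *)

Section Generic.

Variables (K : fieldType) (n t c : nat) (h : 'I_t -> {mpoly K[n]}).
Variables (B : 'I_c -> {set 'I_t}) (kappa : 'I_c -> 'I_n) (D : nat).
Hypotheses (kappa_inj : injective kappa) (D_gt0 : (0 < D)%N).
Hypothesis redB : forall (b : {set 'I_c}) (I : {mpoly K[n]} -> Prop),
  is_ideal I -> (forall i j, i \in b -> j \in B i -> I (h j)) ->
  forall m, red_to I
    (fun m' => mdeg m' = mdeg m /\
      forall i, i \in b -> (m' (kappa i) < D)%N) 'X_[m].

Local Notation r := #|coords B|.

(* The first [r] variables are the coefficients, the last [n] those of [h]. *)
Definition coef_var (u : coords B) : {mpoly K[r + n]} :=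
  'X_(lshift n (enum_rank u)).

Definition embed : {rmorphism {mpoly K[n]} -> {mpoly K[r + n]}} :=
  mmap (@mpolyC (r + n) K) (fun k => 'X_(rshift r k)).

Definition generic_combination (i : 'I_c) : {mpoly K[r + n]} :=
  \sum_(u : coords B | (val u).1 == i) coef_var u * embed (h (val u).2).

Definition embed_mnm (m : 'X_{1..n}) : 'X_{1..(r + n)} :=
  [multinom if split v is inr k then m k else 0%N | v < r + n].

Lemma split_lshift m1 m2 (i : 'I_m1) : split (lshift m2 i) = inl i.
Proof. by rewrite -[lshift _ _]/(unsplit (inl i)) unsplitK. Qed.

Lemma split_rshift m1 m2 (i : 'I_m2) : split (rshift m1 i) = inr i.
Proof. by rewrite -[rshift _ _]/(unsplit (inr i)) unsplitK. Qed.

Lemma embed_mnml m u : embed_mnm m (lshift n u) = 0%N.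
Proof. by rewrite mnmE split_lshift. Qed.

Lemma embed_mnmr m k : embed_mnm m (rshift r k) = m k.
Proof. by rewrite mnmE split_rshift. Qed.

Lemma mdeg_embed m : mdeg (embed_mnm m) = mdeg m.
Proof.
rewrite !mdegE big_split_ord /= big1 ?add0n => [|u _]; last by rewrite embed_mnml.
by apply: eq_bigr => k _; rewrite embed_mnmr.
Qed.

Lemma embedX m : embed 'X_[m] = 'X_[embed_mnm m].
Proof.
rewrite /= mmapX [RHS]mpolyXE_id big_split_ord /= big1 ?mul1r => [|u _].
  by apply: eq_bigr => k _; rewrite embed_mnmr.
by rewrite embed_mnml expr0.
Qed.

Lemma embedZ a p : embed (a *: p) = a *: embed p.
Proof. by rewrite /= mmapZ mul_mpolyC. Qed.

Lemma embedE p : embed p = \sum_(m <- msupp p) p@_m *: 'X_[embed_mnm m].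
Proof.
rewrite {1}(mpolyE p) rmorph_sum; apply: eq_bigr => m _.
by rewrite embedZ embedX.
Qed.

Lemma supp_embed S p : supp_in (fun m => S (embed_mnm m)) p ->
  supp_in S (embed p).
Proof.
move=> Sp; rewrite embedE => m /msupp_sum_le /flatten_mapP[m'].
rewrite mem_filter => /andP[_ /Sp Sm'] /msuppZ_le.
by rewrite msuppX inE => /eqP ->.
Qed.

(* A prime containing the generic combinations: for each [i], either it contains
   [h j] for all [j] in [B i], and powers of the variable [kappa i] can be
   reduced, or one of the coefficients of the [i]-th combination is a rational
   function of the other variables.  In both cases a variable is lost. *)
Section PrimeOverGeneric.

Variables (E : idomainType) (pi : {rmorphism {mpoly K[r + n]} -> E}).
Hypothesis pi_comb : forall i, pi (generic_combination i) = 0.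

Let b : {set 'I_c} :=
  [set i | [forall u : coords B,
    ((val u).1 == i) ==> (pi (embed (h (val u).2)) == 0)]].

Let ideal_pi : is_ideal (fun p => pi p = 0).
Proof.
split=> [|x y px py|a x px]; first exact: rmorph0.
  by rewrite rmorphD px py addr0.
by rewrite rmorphM px mulr0.
Qed.

(** The variable lost at [i]: [kappa i] if the whole class is in the kernel, otherwise the
    coefficient of a member outside the kernel. *)
Let special i v := (i \in b /\ v = rshift r (kappa i)) \/
  exists u : coords B, [/\ i \notin b, (val u).1 = i, pi (embed (h (val u).2)) != 0
    & v = lshift n (enum_rank u)].

Let exists_special i : exists v, special i v.
Proof.
have [ib|ib] := boolP (i \in b); first by exists (rshift r (kappa i)); left.
move: (ib); rewrite inE => /forallPn[u]; rewrite negb_imply => /andP[/eqP ui nz].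
by exists (lshift n (enum_rank u)); right; exists u.
Qed.

Lemma lost_variables : exists (W : {set 'I_(r + n)}) (C : nat)
    (H : {mpoly K[r + n]}),
  [/\ #|W| = c, pi H != 0 & forall s m, (mdeg m <= s)%N ->
    red_to (fun p => pi p = 0)
      (fun m' => mdeg m' <= C * s /\ forall v, v \in W -> (m' v < D)%N)%N
      (H ^+ s * 'X_[m])].
Proof.
have /choice[w wP] := exists_special.
have w_inj : injective w.
  move=> i j; case: (wP i) => [[ib ->]|[u [ib <- _ ->]]];
    case: (wP j) => [[jb ->]|[u' [jb <- _ ->]]].
  - by move=> /rshift_inj/kappa_inj.
  - by move/eqP; rewrite eq_rlshift.
  - by move/eqP; rewrite eq_lrshift.
  - by move=> /lshift_inj/enum_rank_inj ->.
have /choice[hs hsP] : forall i, exists p, pi p != 0 /\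
    (i \notin b -> exists u : coords B, [/\ (val u).1 = i, p = embed (h (val u).2)
      & w i = lshift n (enum_rank u)]).
  move=> i; case: (wP i) => [[ib _]|[u [ib ui nz wi]]].
    by exists 1; rewrite rmorph1 oner_neq0 ib.
  by exists (embed (h (val u).2)); split=> // _; exists u.
(* The common denominator of the eliminated coefficients; monomials satisfying [free] contain none
   of them. *)
pose H := \prod_(i | i \notin b) hs i.
pose free (m : 'X_{1..(r + n)}) := forall i, i \notin b -> m (w i) = 0%N.
have freeM (p q : {mpoly K[r + n]}) :
    supp_in free p -> supp_in free q -> supp_in free (p * q).
  by apply: supp_inM => m1 m2 h1 h2 i ib; rewrite mnmDE h1 ?h2.
have free1 : supp_in free (1 : {mpoly K[r + n]}).
  by rewrite -mpolyX0; apply: supp_inX => i _; rewrite mnm0E.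
have free_embed p : supp_in free (embed p).
  apply: supp_embed => m _ i ib; case: (wP i) => [[]|[u [_ _ _ ->]]].
    by rewrite (negbTE ib).
  by rewrite embed_mnml.
have free_hs i : i \notin b -> supp_in free (hs i).
  by move=> ib; have [_ /(_ ib)[u [_ -> _]]] := hsP i; exact: free_embed.
have free_prod (Q : pred 'I_c) : (forall i, Q i -> i \notin b) ->
    supp_in free (\prod_(i | Q i) hs i).
  move=> Qb; elim/big_ind: _ => // i /Qb; exact: free_hs.
have red_var v : exists2 q, supp_in free q & pi (H * 'X_v - q) = 0.
  have [[i ib wi]|nv] := pselect (exists2 i, i \notin b & w i = v); last first.
    exists (H * 'X_v); last by rewrite subrr rmorph0.
    apply: (freeM); first exact: free_prod.
    apply: supp_inX => i ib; rewrite mnm1E; case: eqP => // vw.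
    by case: nv; exists i.
  have [_ /(_ ib)[u [ui hsi wu]]] := hsP i.
  have Xv : 'X_v = coef_var u by rewrite /coef_var -wu wi.
  (* The vanishing [i]-th combination is solved for its coefficient, with the remaining denominators
     multiplied in. *)
  exists (- (\prod_(i' | (i' \notin b) && (i' != i)) hs i' *
    \sum_(u' : coords B | ((val u').1 == i) && (u' != u))
      coef_var u' * embed (h (val u').2))).
    apply: supp_inN; apply: (freeM); first by apply: (free_prod) => i' /andP[].
    apply: supp_in_sum => u' /andP[/eqP u'i nu']; apply: (freeM) => //.
    apply: supp_inX => i' i'b; rewrite mnm1E; case: eqP => // /esym.
    have [_ /(_ i'b)[u1 [u1i _ wu1]]] := hsP i'.
    rewrite wu1 => /lshift_inj/enum_rank_inj u1u; case/eqP: nu'.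
    apply: enum_rank_inj; apply: (@lshift_inj r n).
    by rewrite -wu -u1u -wu1 -u1i u1u u'i.
  rewrite opprK /H (bigD1 i) //= hsi; set Pr := \prod_(_ | _) _.
  set S := \sum_(_ | _) _.
  have -> : embed (h (val u).2) * Pr * 'X_v + Pr * S =
      Pr * ('X_v * embed (h (val u).2) + S) by ring.
  rewrite rmorphM; apply/eqP; rewrite mulf_eq0; apply/orP; right.
  have := pi_comb i; rewrite /generic_combination (bigD1 u) ?ui //= -Xv.
  by move=> ->.
have /choice[q qP] : forall v, exists q, supp_in free q /\ pi (H * 'X_v - q) = 0.
  by move=> v; have [q ? ?] := red_var v; exists q.
have freeH : supp_in free H by exact: free_prod.
pose C := (msize H + \max_v msize (q v))%N.
have degq p : (msize p <= C)%N -> supp_in (fun m => mdeg m <= C)%N p.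
  by move=> leC m /msize_mdeg_lt /ltnW /leq_trans; exact.
have red_free s m : (mdeg m <= s)%N -> red_to (fun p => pi p = 0)
    (fun m' => mdeg m' <= C * s /\ free m')%N (H ^+ s * 'X_[m]).
  have mulfree p x s' : red_to (fun p => pi p = 0)
      (fun m' => mdeg m' <= C * s' /\ free m')%N x ->
      supp_in (fun m => mdeg m <= C)%N p -> supp_in free p ->
      red_to (fun p => pi p = 0)
        (fun m' => mdeg m' <= C * s'.+1 /\ free m')%N (p * x).
    move=> redx degp freep; apply: red_toMl redx _ => // m' [degm' freem'].
    apply: red_to_supp => //; rewrite mulnS => m1 /msuppM_le /allpairsP[[m2 m3] /=].
    move=> [m2p + ->]; rewrite msuppX inE => /eqP ->; split.
      by rewrite mdegD leq_add // degp.
    by move=> i ib; rewrite mnmDE (freep _ m2p) // freem'.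
  elim: s m => [|s IHs] m degm.
    have /eqP : mdeg m = 0%N by apply/eqP; rewrite -leqn0.
    rewrite mdeg_eq0 => /eqP ->; rewrite expr0 mul1r; apply: red_to_supp => //.
    by apply: supp_inX; rewrite mdeg0; split=> // i _; rewrite mnm0E.
  (* One factor [H] clears the denominator of one variable of the monomial; surplus factors are
     harmless, as [H] itself is [free]. *)
  rewrite exprS; have [m0|m0] := eqVneq m 0%MM.
    rewrite -mulrA; apply: (mulfree) => //.
      by apply: (IHs); rewrite m0 mdeg0.
    by apply: (degq); rewrite leq_addr.
  have [v mv] : exists v, (0 < m v)%N.
    by apply: mnm_eq0P; apply/eqP.
  have mE : m = (U_(v) + (m - U_(v)))%MM by rewrite addmC submK // lep1mP -lt0n.
  have -> : H * H ^+ s * 'X_[m] =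
      q v * (H ^+ s * 'X_[m - U_(v)]) +
      (H ^+ s * 'X_[m - U_(v)]) * (H * 'X_v - q v) :> {mpoly K[r + n]}.
    by rewrite {1}mE mpolyXD; ring.
  apply: red_toD => //; last first.
    by apply: red_to_ideal => //=; rewrite rmorphM (qP v).2 mulr0.
  apply: (mulfree); [|apply: (degq)|by case: (qP v)].
    by apply: (IHs); move: degm; rewrite {1}mE mdegD mdeg1.
  apply: leq_trans (@leq_bigmax _ (fun v => msize (q v)) v) _.
  exact: leq_addl.
exists [set w i | i in 'I_c], C, H; split.
- by rewrite card_imset // card_ord.
- rewrite /H rmorph_prod; apply/prodf_neq0 => i _; by case: (hsP i).
move=> s m degm; apply: red_to_trans (red_free s m degm) _ => // m' [degm' freem'].
(* [redB] is applied to the part [hi] in the variables of [h] only; embedded polynomials contain no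
   coefficient, so the eliminated ones do not return. *)
pose lo := [multinom if split v is inl u then m' (lshift n u) else 0%N | v < r + n].
pose hi := [multinom m' (rshift r k) | k < n].
have m'E : m' = (lo + embed_mnm hi)%MM.
  apply/mnmP => v; rewrite mnmDE !mnmE -{1}(splitK v).
  by case: (split v) => k /=; rewrite ?addn0 // mnmE.
rewrite {1}m'E mpolyXD -embedX.
pose I p := pi (embed p) = 0.
have idI : is_ideal I.
  split=> [|x y px py|a x px]; rewrite /I; first by rewrite !rmorph0.
    by rewrite !rmorphD px py addr0.
  by rewrite !rmorphM px mulr0.
have [|g gS Ig] := redB (b := b) idI _ hi.
  move=> i j; rewrite inE => /forallP hb jB.
  by have /implyP/(_ (eqxx _))/eqP := hb (exist _ (i, j) jB).
exists ('X_[lo] * embed g).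
  move=> m1 /msuppM_le /allpairsP[[m2 m3] /= [+ + ->]].
  rewrite msuppX inE => /eqP ->.
  have : supp_in (fun m => exists2 m4, m4 \in msupp g & m = embed_mnm m4) (embed g).
    by apply: supp_embed => m4 m4g; exists m4.
  move=> /[apply] -[m4 /gS[degm4 m4b] ->]; split.
    rewrite mdegD mdeg_embed degm4 -mdeg_embed -mdegD -m'E //.
  move=> _ /imsetP[i _ ->]; case: (wP i) => [[ib ->]|[u [ib _ _ wi]]].
    by rewrite mnmDE embed_mnmr mnmE split_rshift add0n m4b.
  by rewrite wi mnmDE embed_mnml addn0 mnmE split_lshift -wi freem'.
by rewrite /= -mulrBr -rmorphB rmorphM Ig mulr0.
Qed.

End PrimeOverGeneric.

(** The [s.+1 ^ #|Z|] independent monomials, multiplied by a power of [H], reduce to monomials in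
    which [c] exponents are bounded. Since [H] is nonzero modulo the prime, it cancels from any
    relation. *)
Lemma generic_indep_le (Z : {set 'I_(r + n)}) : (c <= n)%N ->
  indep_vars (gen_ideal (fun q => exists i, q = generic_combination i)) Z ->
  (#|Z| <= r + n - c)%N.
Proof.
move=> lecn indZ.
have [P [prP IP indP]] := exists_prime_indep (gen_ideal_is_ideal _) indZ.
have [E [pi piP]] := prime_ideal_ker prP.
have pi_comb i : pi (generic_combination i) = 0.
  by apply/eqP; rewrite -piP; apply: IP; apply: mem_gen_ideal; exists i.
have [W [C [H [cW piH redH]]]] := lost_variables pi_comb.
apply: (@growth_le (D ^ c) (C * (r + n))) => s; rewrite leqNgt; apply/negP => ltT.
have id_pi : is_ideal (fun p => pi p = 0).
  split=> [|x y px py|a x px]; first exact: rmorph0.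
    by rewrite rmorphD px py addr0.
  by rewrite rmorphM px mulr0.
(* Bounds the degree of every monomial with exponents at most [s]. *)
pose N := ((r + n) * s)%N.
have [||a [[f af] pia]] := @box_dependent K (r + n) (fun p => pi p = 0)
    (fun v => if v \in W then D else (C * N).+1)
    (box (fun v => if v \in Z then s.+1 else 1%N))
    (fun f => H ^+ N * 'X_[box_mnm f]) id_pi.
- move=> f; have [|q qS piq] := redH N (box_mnm f).
    rewrite mdegE /N -[X in (_ <= X * _)%N]card_ord -sum_nat_const.
    by apply: leq_sum => v _; rewrite mnmE; case: (f v) => j /=; case: ifP; case: j.
  exists q; split=> //; apply: supp_inW qS => m [degm mW] v; case: ifP => [/mW //|_].
  by rewrite ltnS (leq_trans _ degm) // mdegE (bigD1 v) //= leq_addr.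
- by rewrite !card_box_if exp1n muln1 cW /N mulnA.
have : \sum_f a f *: 'X_[box_mnm f] \in P.
  rewrite piP; move: pia; under eq_bigr do rewrite scalerAr.
  rewrite -mulr_sumr rmorphM rmorphXn => /eqP.
  by rewrite mulf_eq0 expf_eq0 (negbTE piH) andbF.
move=> /(indP _ (@box_poly_in _ _ _ _ a)) a0.
by move/eqP: af; apply; rewrite -(box_coef a) a0 mcoeff0.
Qed.

End Generic.

(** * Specialization of the coefficients *)

Section Specialization.

Variables (K : fieldType) (n t c : nat) (h : 'I_t -> {mpoly K[n]}).
Variable (B : 'I_c -> {set 'I_t}).

Local Notation r := #|coords B|.

Definition split_vars : {rmorphism {mpoly K[r + n]} -> {mpoly {mpoly K[r]}[n]}} :=
  mmap (@mpolyC n {mpoly K[r]} \o @mpolyC r K)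
    (fun v => match split v with inl u => ('X_u)%:MP | inr k => 'X_k end).

Lemma split_vars_inj : injective split_vars.
Proof.
pose back : {rmorphism {mpoly {mpoly K[r]}[n]} -> {mpoly K[r + n]}} :=
  mmap (mmap (@mpolyC (r + n) K) (fun u => 'X_(lshift n u)))
    (fun k => 'X_(rshift r k)).
apply: (@can_inj _ _ _ back) => p.
apply: (@mpoly_rmorph_eq _ _ _ (back \o split_vars) idfun) => [a|v] /=.
  by rewrite !mmapC /= !mmapC.
rewrite mmapX mmap1U -{2}(splitK v); case: (split v) => u /=.
  by rewrite mmapC /= mmapX mmap1U.
by rewrite mmapX mmap1U.
Qed.

Section Point.

Variables (L : fieldType) (iota : {rmorphism K -> L}) (a : coords B -> L).

Definition specialize : {rmorphism {mpoly K[r + n]} -> {mpoly L[n]}} :=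
  mmap (@mpolyC n L \o iota)
    (fun v => match split v with inl u => (a (enum_val u))%:MP | inr k => 'X_k end).

Let eval : {rmorphism {mpoly K[r]} -> L} := mmap iota (fun u => a (enum_val u)).

Lemma specialize_coef p m :
  (specialize p)@_m = mmap iota (fun u => a (enum_val u)) (split_vars p)@_m.
Proof.
rewrite -[RHS]/(eval _) -mcoeff_map_mpoly; congr (_ @_ m).
apply: (@mpoly_rmorph_eq _ _ _ specialize (map_mpoly eval \o split_vars)) => [b|v].
  rewrite [LHS]mmapC; transitivity
    (map_mpoly eval ((b%:MP)%:MP : {mpoly {mpoly K[r]}[n]})).
    by rewrite /map_mpoly mmapC /= mmapC.
  by congr map_mpoly; rewrite [RHS]mmapC.
rewrite [LHS]mmapX mmap1U; transitivity (map_mpoly eval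
    (match split v with inl u => ('X_u)%:MP | inr k => 'X_k end :
      {mpoly {mpoly K[r]}[n]})).
  by case: (split v) => u; rewrite /map_mpoly ?mmapC ?mmapX ?mmap1U //= mmapX mmap1U.
by congr map_mpoly; rewrite [RHS]mmapX mmap1U.
Qed.

Lemma specialize_embed p : specialize (embed K n B p) = map_mpoly iota p.
Proof.
apply: (@mpoly_rmorph_eq _ _ _ (specialize \o embed K n B) (map_mpoly iota)) => [b|k].
  transitivity (specialize b%:MP); first by congr (specialize _); exact: mmapC.
  by rewrite /map_mpoly [LHS]mmapC [RHS]mmapC.
transitivity (specialize 'X_(rshift r k)).
  by congr (specialize _); rewrite [LHS]mmapX mmap1U.
by rewrite /map_mpoly [LHS]mmapX [RHS]mmapX !mmap1U split_rshift.
Qed.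

Lemma specialize_generic i :
  specialize (generic_combination h B i) = combination iota h a i.
Proof.
rewrite rmorph_sum; apply: eq_bigr => u _.
rewrite rmorphM specialize_embed -mul_mpolyC; congr (_ * _).
by rewrite /= mmapX mmap1U split_lshift enum_rankK.
Qed.

Lemma specialize_poly_in (Y : {set 'I_n}) p :
  poly_in ([set lshift n u | u in 'I_r] :|: [set rshift r k | k in Y]) p ->
  poly_in Y (specialize p).
Proof.
move=> pY; rewrite /= /mmap; rewrite big_seq; apply: supp_in_sum => m /pY mY.
rewrite /= mul_mpolyC; apply: supp_inZ.
apply: (big_ind (poly_in Y)) => [|x y|v _]; [exact: poly_in1|exact: poly_inM|].
have [mv|mv] := posnP (m v); first by rewrite mv expr0; exact: poly_in1.
have powY x : poly_in Y x -> poly_in Y (x ^+ m v).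
  move=> xY; elim: (m v) => [|e IHe]; first by rewrite expr0; exact: poly_in1.
  by rewrite exprS; exact: poly_inM.
apply: powY; case E: (split v) => [u|k].
  by rewrite -[_%:MP]mulr1 mul_mpolyC; apply: supp_inZ; exact: poly_in1.
apply: supp_inX => i iY; rewrite mnm1E; case: eqP => // ki.
move: mv; rewrite mY // -(splitK v) E /= inE negb_or; apply/andP; split.
  by apply/imsetP => -[u _] /eqP; rewrite eq_rlshift.
by apply: contraNN iY => /imsetP[k' k'Y /rshift_inj]; rewrite -ki => ->.
Qed.

End Point.

(** The point whose coordinates are the variables themselves, in the fraction field of the
    coordinate ring; this covers finite [K]. *)
Lemma generic_point (g : {mpoly K[r]}) : g != 0 ->
  nonempty_open [:: g : {mpoly K[#|coords B|]}].
Proof.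
move=> g0; pose L := {fraction {mpoly K[r]}}.
pose tof : {rmorphism {mpoly K[r]} -> L} := @tofrac {mpoly K[r]}.
pose iota : {rmorphism K -> L} := tof \o @mpolyC r K.
exists L, iota, (fun u => tof 'X_(enum_rank u)), g; first by rewrite mem_head.
suff -> : mmap iota (fun k => tof 'X_(enum_rank (enum_val k))) g = tof g.
  by rewrite /= tofrac_eq0.
pose ev : {rmorphism {mpoly K[r]} -> L} :=
  mmap iota (fun k => tof 'X_(enum_rank (enum_val k))).
apply: (@mpoly_rmorph_eq _ _ _ ev tof) => [b|k]; first by rewrite /= mmapC.
by rewrite /= mmapX mmap1U enum_valK.
Qed.

End Specialization.

(** All coefficients together with [Y] are one variable too many for [generic_indep_le], which gives
    a relation [q]. Where [g], one coefficient of [q], does not vanish, [q] specializes to a nonzero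
    relation in [Y]. *)
Lemma generic_dependent (K : fieldType) (n t c : nat) (h : 'I_t -> {mpoly K[n]})
    (B : 'I_c -> {set 'I_t}) (kappa : 'I_c -> 'I_n) (D : nat) (Y : {set 'I_n}) :
  injective kappa -> (0 < D)%N ->
  (forall (b : {set 'I_c}) (I : {mpoly K[n]} -> Prop),
    is_ideal I -> (forall i j, i \in b -> j \in B i -> I (h j)) ->
    forall m, red_to I (fun m' => mdeg m' = mdeg m /\
      forall i, i \in b -> (m' (kappa i) < D)%N) 'X_[m]) ->
  (c <= n)%N -> #|Y| = (n - c).+1 ->
  exists2 g : {mpoly K[#|coords B|]}, g != 0 &
    forall (L : fieldType) (iota : {rmorphism K -> L}) (a : coords B -> L),
      mmap iota (fun u => a (enum_val u)) g != 0 ->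
      ~ indep_vars (gen_ideal (fun q => exists i, q = combination iota h a i)) Y.
Proof.
move=> kappa_inj D0 redB lecn cY.
set r := #|coords B|.
pose Z := [set lshift n u | u in 'I_r] :|: [set rshift r k | k in Y].
have cZ : #|Z| = (r + (n - c).+1)%N.
  rewrite cardsU disjoint_setI0 ?cards0 ?subn0.
    by rewrite !card_imset ?cY ?card_ord //; [exact: rshift_inj|exact: lshift_inj].
  rewrite disjoint_subset; apply/subsetP => v /imsetP[u _ ->]; rewrite inE.
  by apply/imsetP => -[k _] /eqP; rewrite eq_lrshift.
have [q [qZ Iq q0]] : exists q, [/\ poly_in Z q,
    gen_ideal (fun q => exists i, q = generic_combination h B i) q & q != 0].
  apply: not_indep_vars => /(generic_indep_le kappa_inj D0 redB lecn).
  by rewrite cZ -addnBA // addnS ltnn.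
pose m := mlead (split_vars K n B q).
exists (split_vars K n B q)@_m.
  rewrite mleadc_eq0 -(rmorph0 (split_vars K n B)).
  by rewrite (inj_eq (@split_vars_inj _ _ _ _ _)).
move=> L iota a; rewrite -specialize_coef => nz indY.
move/eqP: nz; apply; rewrite (indY (specialize n iota a q)) ?mcoeff0 //.
  exact: specialize_poly_in.
have idL := gen_ideal_is_ideal (fun q => exists i, q = combination iota h a i).
apply: (@gen_ideal_sub _ _ (fun p => gen_ideal _ (specialize n iota a p)) _ _ _ Iq).
  split=> [|x y Ix Iy|x y Iy].
  - by rewrite rmorph0; exact: ideal0.
  - by rewrite rmorphD; exact: idealD.
  - by rewrite rmorphM; exact: idealM.
by move=> _ [i ->]; apply: mem_gen_ideal; exists i; exact: specialize_generic.
Qed.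

Theorem theorem7p4 (K : fieldType) (n c t : nat)
    (J : {mpoly K[n.+1]} -> Prop) (P : t.-tuple 'X_{1..n.+1})
    (h : 'I_t -> {mpoly K[n.+1]})
    (c_gt0 : (0 < c)%N)
    (J_quasi_stable : quasi_stable J)
    (J_codim : codim J c)
    (P_uniq : uniq P)
    (P_pommaret : pommaret_basis J P)
    (h_marked : marked_basis J P h) :
  exists (S : {set 'I_t}) (B : 'I_c -> {set 'I_t}),
    [/\ S != set0,
        S = \bigcup_(i < c) B i,
        forall i, B i != set0,
        forall i j, i != j -> [disjoint B i & B j]
      & exists U : zariski_open K (coords B),
          nonempty_open U /\
          forall (L : fieldType) (iota : {rmorphism K -> L})
                 (r : coords B -> L),
            in_open U iota r ->
            codim (gen_ideal (fun q => exists i, q = combination iota h r i)) c].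
Proof.
have markedh := h_marked.1.
have J1 : ~ J 1.
  by have [_ [Q [prQ JQ _]]] := J_codim => /JQ; apply/negP; exact: prime_ideal1.
have lecT := codim_le_pure_powers J1 J_quasi_stable J_codim.
set T := pure_power_vars J in lecT.
pose kappa (i : 'I_c) : 'I_n.+1 := enum_val (widen_ord lecT i).
have kappaT i : kappa i \in T by exact: enum_valP.
have kappa_inj : injective kappa.
  by move=> i j /enum_val_inj /(congr1 val) /= /val_inj.
have lecn : (c <= n.+1)%N.
  by apply: (leq_trans lecT); rewrite -[X in (_ <= X)%N]card_ord max_card.
pose B (i : 'I_c) := [set j | `[< is_min_var (tnth P j) (kappa i) >]].
have BP i j : j \in B i -> is_min_var (tnth P j) (kappa i).
  by rewrite inE => /asboolP.
(* A power of the variable [kappa i] lies in [J]; the head term dividing it is itself a power of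
   that variable. *)
have B0 i : B i != set0.
  have := kappaT i; rewrite inE => /asboolP[d Jd].
  have [j [dl [/mnmP dE _]]] := pommaret_decomp P_pommaret Jd.
  apply/set0Pn; exists j; rewrite inE; apply/asboolP.
  have [k mink] := exists_min_var (pommaret_neq0 J1 P_pommaret (j := j)).
  suff -> : kappa i = k by [].
  have := dE k; rewrite mnmDE mulmnE mnm1E; case: eqP => // _.
  move=> /esym/eqP; rewrite mul0n addn_eq0 => /andP[_ /eqP k0].
  by have [] := mink; rewrite k0.
have [D D0 red] := marked_reduction J1 J_quasi_stable P_pommaret markedh.
have redB (b : {set 'I_c}) (I : {mpoly K[n.+1]} -> Prop) : is_ideal I ->
    (forall i j, i \in b -> j \in B i -> I (h j)) ->
    forall m, red_to I (fun m' => mdeg m' = mdeg m /\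
      forall i, i \in b -> (m' (kappa i) < D)%N) 'X_[m].
  (* Each exponent in [A] is at most the degree in [A], which [red] bounds. *)
  move=> idI Ih m; pose A := [set kappa i | i in b].
  have AT : A \subset T by apply/subsetP => _ /imsetP[i _ ->].
  have [|q qS Iq] := red A I AT idI _ m.
    move=> j k mink /imsetP[i ib ki]; apply: (Ih i) => //.
    by rewrite inE -ki; apply/asboolP.
  exists q => //; apply: supp_inW qS => m' [degm' ltm']; split=> // i ib.
  apply: leq_ltn_trans ltm'; rewrite /degree_in (bigD1 (kappa i)) ?leq_addr //=.
  exact: imset_f.
exists (\bigcup_(i < c) B i), B; split=> //.
- have /set0Pn[j jB] := B0 (Ordinal c_gt0).
  by apply/set0Pn; exists j; apply/bigcupP; exists (Ordinal c_gt0).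
- move=> i j nij; rewrite disjoint_subset; apply/subsetP => k /BP mini.
  rewrite inE; apply/negP => /BP minj; case/eqP: nij; apply: kappa_inj.
  exact: min_var_uniq mini minj.
have /choice[g gP] : forall Y : {set 'I_n.+1}, exists g : {mpoly K[#|coords B|]},
    g != 0 /\ (#|Y| = (n.+1 - c).+1 ->
    forall (L : fieldType) (iota : {rmorphism K -> L}) (a : coords B -> L),
      mmap iota (fun u => a (enum_val u)) g != 0 ->
      ~ indep_vars (gen_ideal (fun q => exists i, q = combination iota h a i)) Y).
  move=> Y; have [cY|cY] := pselect (#|Y| = (n.+1 - c).+1).
    have [g g0 gP] := generic_dependent kappa_inj D0 redB lecn cY.
    by exists g.
  (* Sets of another size impose no condition. *)
  by exists 1; rewrite oner_neq0.
(* [in_open] asks for one nonvanishing member, so the conditions for all [Y] are joined in a single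
   product. *)
exists [:: \prod_Y g Y]; split.
  by apply: generic_point; apply/prodf_neq0 => Y _; case: (gP Y).
move=> L iota a [_ /[!inE] /eqP-> nz]; apply: codim_gen_ideal => // [i|Y cY].
  rewrite /combination raddf_sum big1 // => u _.
  rewrite /= mcoeffZ mcoeff_map_mpoly (marked_coef0 J1 P_pommaret markedh).
  by rewrite raddf0 mulr0.
apply: (gP Y).2 => //; apply: contra nz => /eqP gY0.
by rewrite rmorph_prod (bigD1 Y) //= gY0 mul0r.
Qed.
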